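(* Let $\mathcal{U}$ be a group of unitary operators on a Hilbert space $\mathcal{H}$. Suppose that $f\in\mathcal{H}$ is a frame vector for $\mathcal{U}$ with optimal frame bounds $A^{2}$ and $B^{2}$, where $0<A\le B<\infty$. Then there exist: (i) a Hilbert space $\mathcal{K}\supseteq\mathcal{H}$ and a unitary group $\mathcal{V}$ on $\mathcal{K}$ (a group of unitary operators on $\mathcal K$) such that the restriction map $\mathcal{V}\ni V\mapsto V|_{\mathcal{H}}$ is a group isomorphism of $\mathcal{V}$ onto $\mathcal{U}$; (ii) a positive operator $E:\mathcal{K}\to\mathcal{H}$ such that $\{A,B\}\subseteq\sigma(E|_{\mathcal{H}})\subseteq[A,B]$; and (iii) a complete wandering vector $e\in\mathcal{K}$ for $\mathcal{V}$ such that $E\mathcal{V}e=\mathcal{V}f=\mathcal{U}f$. More precisely, $E(Ve)=Vf$ for all $V\in\mathcal{V}$.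
   Context: A family $\{f_i\}_{i\in I}$ in a Hilbert space $\mathcal{H}$ is a frame for $\mathcal{H}$ if there exist $0<a\le b<\infty$ (frame bounds) such that $a\|g\|^2\le\sum_{i\in I}|\langle g,f_i\rangle|^2\le b\|g\|^2$ for all $g\in\mathcal{H}$. The optimal frame bounds are the supremum of all admissible $a$ and the infimum of all admissible $b$. For a set $\mathcal{U}$ of unitary operators on $\mathcal{H}$: a vector $f\in\mathcal{H}$ is a frame vector for $\mathcal{U}$ (with given bounds) if the family $\{Uf\}_{U\in\mathcal{U}}$, indexed by $\mathcal{U}$, is a frame for $\mathcal{H}$ (with those bounds); a vector $e\in\mathcal{H}$ is a complete wandering vector for $\mathcal{U}$ if $\{Ue\}_{U\in\mathcal{U}}$, indexed by $\mathcal{U}$, is an orthonormal basis of $\mathcal{H}$. The notation $\mathcal{U}f$ means $\{Uf:U\in\mathcal{U}\}$. $\mathcal{K}\supseteq\mathcal{H}$ means $\mathcal{H}$ is a closed subspace of $\mathcal{K}$ with the inherited inner product. A positive operator $E:\mathcal{K}\to\mathcal{H}$ means a bounded positive (self-adjoint) operator on $\mathcal{K}$ with range contained in $\mathcal{H}$; $\sigma(E|_{\mathcal{H}})$ is the spectrum of the restriction $E|_{\mathcal{H}}:\mathcal{H}\to\mathcal{H}$. *)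

(* Defs.v *)
From HB Require Import structures.
From mathcomp Require Import all_boot all_order all_algebra.
From mathcomp Require Import all_classical all_reals all_analysis.
From mathcomp Require Import complex.
Set Implicit Arguments.
Unset Strict Implicit.
Unset Printing Implicit Defensive.
Import Order.TTheory GRing.Theory Num.Theory.
Import numFieldNormedType.Exports.
Local Open Scope classical_set_scope.
Local Open Scope complex_scope.
Local Open Scope ring_scope.

(* Complex Hilbert spaces. [inner] is linear in its first argument and
   conjugate-linear in its second. *)
HB.mixin Record CompleteNormedModule_isHilbert (R : realType) H
    of CompleteNormedModule R[i] H := {
  inner : {dot H for (Num.conj : R[i] -> R[i])};
  inner_normE : forall x : H, `|x| ^+ 2 = inner x x
}.

#[short(type="hilbertType")]
HB.structure Definition Hilbert (R : realType) :=
  {H of CompleteNormedModule R[i] H & CompleteNormedModule_isHilbert R H}.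

Notation "''[' x , y ]" := (inner x y) : ring_scope.

Section operators.
Context {R : realType}.
Implicit Types H K : hilbertType R.

Definition bounded_op H (T : H -> H) : Prop :=
  linear T /\ exists M : R, forall x, `|T x| <= M%:C * `|x|.

Definition unitary_op H (T : H -> H) : Prop :=
  [/\ linear T, bijective T & forall x y, '[T x, T y] = '[x, y]].

Definition unitary_group H (U : set (H -> H)) : Prop :=
  [/\ forall T, U T -> unitary_op T,
      U idfun,
      forall S T, U S -> U T -> U (S \o T)
    & forall T, U T -> exists2 S, U S & cancel T S /\ cancel S T].

(* The order of R[i] makes the last clause say that '[T x, x] is real
   and nonnegative. *)
Definition positive_op H (T : H -> H) : Prop :=
  [/\ bounded_op T,
      forall x y, '[T x, y] = '[x, T y]
    & forall x, 0 <= '[T x, x]].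

Definition spectrum H (T : H -> H) : set R[i] :=
  [set l | ~ exists S : H -> H,
     [/\ bounded_op S, forall x, S (T x - l *: x) = x
       & forall x, T (S x) - l *: S x = x]].

(* The inclusion of H as a closed subspace of K, with the inherited inner
   product; H is identified with [range J]. *)
Definition hilbert_inclusion H K (J : H -> K) : Prop :=
  [/\ linear J, forall x y, '[J x, J y] = '[x, y] & closed (range J)].

Definition invariant_range H K (J : H -> K) (T : K -> K) : Prop :=
  T @` range J `<=` range J.

(* The restriction of T to H, seen as a map from H to H; it is meaningful
   when J is injective and [invariant_range J T], and then J \o restr J T = T \o J. *)
Definition restr H K (J : H -> K) (T : K -> K) : H -> H :=
  fun x => xget 0 [set y | J y = T (J x)].

End operators.

Section families.
Context {R : realType} {H : hilbertType R} {I : choiceType}.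
Implicit Types (D : set I) (phi : I -> H) (a b : R).

(* The families are indexed by D, so repeated vectors count with their
   multiplicity. *)
Definition frame_bounds D phi a b : Prop :=
  0 < a <= b /\
  forall g : H,
    let s := (\esum_(i in D) (complex.Re (`|'[g, phi i]| ^+ 2))%:E)%R in
    ((a * complex.Re (`|g| ^+ 2))%:E <= s)%E /\ (s <= (b * complex.Re (`|g| ^+ 2))%:E)%E.

Definition is_frame D phi : Prop := exists a b, frame_bounds D phi a b.

Definition optimal_frame_bounds D phi a b : Prop :=
  [/\ is_frame D phi,
      supremums [set a' | exists b', frame_bounds D phi a' b'] a
    & infimums [set b' | exists a', frame_bounds D phi a' b'] b].

Definition linear_span D phi : set H :=
  [set x | exists (s : seq I) (c : I -> R[i]),
     (forall i, i \in s -> D i) /\ x = \sum_(i <- s) c i *: phi i].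

Definition orthonormal_basis D phi : Prop :=
  (forall i j, D i -> D j -> '[phi i, phi j] = (i == j)%:R) /\
  closure (linear_span D phi) = setT.

End families.

Section vectors.
Context {R : realType} {H : hilbertType R}.
Implicit Types (U : set (H -> H)).

Definition frame_vector_optimal U (f : H) (a b : R) : Prop :=
  optimal_frame_bounds U (fun T : H -> H => T f) a b.

Definition complete_wandering_vector U (e : H) : Prop :=
  orthonormal_basis U (fun T : H -> H => T e).

End vectors.

(* Main.v *)
Require Import Defs.
From HB Require Import structures.
From mathcomp Require Import all_boot all_order all_algebra.
From mathcomp Require Import all_classical all_reals all_analysis.
From mathcomp Require Import complex.
From mathcomp Require Import finmap ring lra.
Set Implicit Arguments.
Unset Strict Implicit.
Unset Printing Implicit Defensive.
Import Order.TTheory GRing.Theory Num.Theory.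
Import numFieldNormedType.Exports.
Local Open Scope classical_set_scope.
Local Open Scope complex_scope.
Local Open Scope ring_scope.

(** The frame vector [f] has an analysis operator
    [theta g = (<g, W f>)_(W in U)], from [H] to [K := l^2(U)], and a frame
    operator [S = theta^* theta].  The optimal bounds say exactly that [A^2] and
    [B^2] are the best constants with [A^2 <= S <= B^2].  Since [U] is a group,
    [theta (W g)] is the left translate of [theta g] by [W], so that [theta]
    intertwines [U] with the left regular representation of [U] on [l^2(U)], and
    [S] commutes with [U].

    Let [T] be the positive square root of [S]; it commutes with [U] as well,
    and it is invertible because [A > 0].  By polar decomposition
    [J := theta T^-1] is an isometry of [H] into [K], and it still intertwines
    [U] with the regular representation.  So [H] sits in [K] through [J], the
    group [V] of left translations restricts to [U], and the point mass [e] at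
    the identity of [U] is a complete wandering vector for [V].  Put
    [E := J T J^*].  It is positive with range in [J H], its restriction to [H]
    is [T], and [E (V e) = J T T^-1 theta^* (V e) = J (V f)], because the
    synthesis operator [theta^*] sends the point mass at [V] to [V f].

    The spectrum of [T] lies in [[A, B]] since [A <= T <= B].  If [A] were not in
    it then, [- A] not being in it either, [S - A^2 = (T - A)(T + A)] would be a
    positive invertible operator; such an operator is bounded below, so the lower
    frame bound could be increased.  The endpoint [B] is similar.

    The operator theory needed for this is built on two facts about a complete
    inner product space: sequences with geometrically decreasing increments
    converge with a geometric error ([cvg_geometric]), and bounded real-linear
    functionals are represented by vectors ([riesz]).  They give adjoints
    ([adjoint_exists]), inverses of coercive operators
    ([coercive_invertible]) and square roots ([sqrt_op]).  The space [l^2] is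
    constructed with its inner product obtained by polarisation from
    [sum_i |x_i|^2], so that only sums of nonnegative terms ever occur. *)

(** * Real inner product and norm of a complex Hilbert space *)

Lemma Re_norm_ge0 (R : rcfType) (z : R[i]) : 0 <= complex.Re `|z|.
Proof. by have := normr_ge0 z; rewrite lecE => /andP[]. Qed.

Section geometric.
Context {R : realType}.

Lemma geometric_small (C r e : R) : 0 <= r < 1 -> 0 < e -> exists n, C * r ^+ n < e.
Proof.
move=> /andP[r0 r1] e0.
have : (fun n => C * r ^+ n) @ \oo --> C * 0.
  by apply: cvgMr; apply: cvg_expr; rewrite ger0_norm.
rewrite mulr0 => /cvgr0Pnorm_lt /(_ e e0) [n _ /(_ n (leqnn n))] /=.
by move=> h; exists n; apply: le_lt_trans h; exact: ler_norm.
Qed.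

(** Inequalities and equalities between limits of vectors are derived from error terms
    [C * r ^+ n] valid for every [n], which avoids manipulating limits. *)
Lemma le_geometric (a b C r : R) : 0 <= r < 1 ->
  (forall n, a <= b + C * r ^+ n) -> a <= b.
Proof.
move=> r01 h; rewrite leNgt; apply/negP => ba.
have ab : 0 < a - b by rewrite subr_gt0.
by have [n hn] := geometric_small C r01 ab; have := h n; lra.
Qed.

End geometric.

Section hilbert.
Context {R : realType} {H : hilbertType R}.
Implicit Types (x y z : H) (t : R).

(** Most estimates only involve real scalars: [H] is used as a real inner product
    space, with real-valued inner product and norm, and the complex structure is
    recovered through [inner_rdotE]. *)
Definition rdot x y : R := complex.Re '[x, y].
Definition nrm x : R := complex.Re `|x|.

Lemma normE x : `|x| = (nrm x)%:C.
Proof. by rewrite /nrm RRe_real// ger0_real. Qed.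

Lemma nrm_ge0 x : 0 <= nrm x.
Proof. by rewrite -ler0c -normE. Qed.

Lemma innerC x y : '[x, y] = ('[y, x])^*%C.
Proof. by rewrite hermC expr0 mul1r. Qed.

Lemma innerDl x y z : '[x + y, z] = '[x, z] + '[y, z].
Proof. by rewrite linearDl. Qed.

Lemma innerDr x y z : '[x, y + z] = '[x, y] + '[x, z].
Proof. by rewrite linearDr. Qed.

Lemma innerZl (a : R[i]) x y : '[a *: x, y] = a * '[x, y].
Proof. by rewrite linearZl_LR. Qed.

Lemma innerZr (a : R[i]) x y : '[x, a *: y] = a^*%C * '[x, y].
Proof. by rewrite linearZr_LR. Qed.

Lemma nrm_sqr x : nrm x ^+ 2 = rdot x x.
Proof. by rewrite /rdot -inner_normE normE -rmorphXn. Qed.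

Lemma inner_nrm x : '[x, x] = (nrm x ^+ 2)%:C.
Proof. by rewrite -inner_normE normE -rmorphXn. Qed.

Lemma rdotC x y : rdot x y = rdot y x.
Proof. by rewrite /rdot innerC; case: '[y, x]. Qed.

Lemma rdotDl x y z : rdot (x + y) z = rdot x z + rdot y z.
Proof. by rewrite /rdot innerDl; case: '[x, z] '[y, z] => ? ? []. Qed.

Lemma rdotZl t x y : rdot (t%:C *: x) y = t * rdot x y.
Proof. by rewrite /rdot innerZl; case: '[x, y] => ? ? /=; rewrite mul0r subr0. Qed.

Lemma rdotDr x y z : rdot x (y + z) = rdot x y + rdot x z.
Proof. by rewrite rdotC rdotDl !(rdotC x). Qed.

Lemma rdotZr t x y : rdot x (t%:C *: y) = t * rdot x y.
Proof. by rewrite rdotC rdotZl rdotC. Qed.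

Lemma rdotNl x y : rdot (- x) y = - rdot x y.
Proof. by rewrite -scaleN1r (_ : -1 = (-1)%:C) ?rdotZl ?mulN1r// rmorphN1. Qed.

Lemma rdotNr x y : rdot x (- y) = - rdot x y.
Proof. by rewrite rdotC rdotNl rdotC. Qed.

Definition rdotE := (rdotDl, rdotDr, rdotZl, rdotZr, rdotNl, rdotNr).

Lemma rdot0l x : rdot 0 x = 0.
Proof. by have := rdotZl 0 0 x; rewrite scaler0 mul0r. Qed.

Lemma rdotIl x y : rdot ('i%C *: x) y = - complex.Im '[x, y].
Proof. by rewrite /rdot innerZl; case: '[x, y] => a b /=; simpc; rewrite /=; ring. Qed.

(** A complex linear map preserves the complex inner product as soon as it
    preserves its real part, because [Im <x, y> = - Re <i x, y>]. *)
Lemma inner_rdotE x y : '[x, y] = rdot x y +i* - rdot ('i%C *: x) y.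
Proof. by rewrite rdotIl opprK /rdot; case: '[x, y]. Qed.

Lemma nrm_eq0 x : nrm x = 0 -> x = 0.
Proof. by move=> h; apply/normr0_eq0; rewrite normE h. Qed.

Lemma nrm0 : nrm (0 : H) = 0.
Proof. by rewrite /nrm normr0. Qed.

Lemma nrmN x : nrm (- x) = nrm x.
Proof. by rewrite /nrm normrN. Qed.

Lemma nrmBC x y : nrm (x - y) = nrm (y - x).
Proof. by rewrite -nrmN opprB. Qed.

Lemma nrmD x y : nrm (x + y) <= nrm x + nrm y.
Proof. by rewrite -lecR rmorphD/= -!normE; exact: ler_normD. Qed.

Lemma nrmZ (a : R[i]) x : nrm (a *: x) = complex.Re `|a| * nrm x.
Proof.
rewrite {1}/nrm normrZ normE -[X in X * _]RRe_real ?normr_real//.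
by rewrite -rmorphM.
Qed.

Lemma nrmZr t x : nrm (t%:C *: x) = `|t| * nrm x.
Proof. by rewrite nrmZ normc_def/= expr0n addr0 sqrtr_sqr. Qed.

Lemma scale2 x : (2 : R)%:C *: x = x + x.
Proof. by rewrite -[2]/(1 + 1) rmorphD/= scalerDl scale1r. Qed.

Lemma nrm_tri x y z : nrm (x - z) <= nrm (x - y) + nrm (y - z).
Proof. by rewrite -[x - z](subrKA y); exact: nrmD. Qed.

Lemma rdot_ext x y : (forall z, rdot z x = rdot z y) -> x = y.
Proof.
move=> h; apply/eqP; rewrite -subr_eq0; apply/eqP/nrm_eq0/eqP.
by rewrite -sqrf_eq0 nrm_sqr rdotDr rdotNr h subrr.
Qed.

Lemma inner_ext x y : (forall z, '[z, x] = '[z, y]) -> x = y.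
Proof. by move=> h; apply: rdot_ext => z; rewrite /rdot h. Qed.

(** Expand [| |y| x - |x| y |^2 >= 0]. *)
Lemma cauchy_schwarz x y : rdot x y <= nrm x * nrm y.
Proof.
have [->|x0] := eqVneq x 0; first by rewrite rdot0l nrm0 mul0r.
have px : 0 < nrm x.
  by rewrite lt_neqAle nrm_ge0 andbT eq_sym; apply: contra_neq x0; exact: nrm_eq0.
have [->|y0] := eqVneq y 0; first by rewrite rdotC rdot0l nrm0 mulr0.
have py : 0 < nrm y.
  by rewrite lt_neqAle nrm_ge0 andbT eq_sym; apply: contra_neq y0; exact: nrm_eq0.
have : 0 <= nrm ((nrm y)%:C *: x - (nrm x)%:C *: y) ^+ 2 by exact: sqr_ge0.
rewrite nrm_sqr !rdotE -!nrm_sqr (rdotC y) => h.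
rewrite -(ler_pM2l (mulr_gt0 px py)); lra.
Qed.

Lemma abs_cauchy_schwarz x y : `|rdot x y| <= nrm x * nrm y.
Proof.
by rewrite ler_norml cauchy_schwarz -(nrmN x) lerNl -rdotNl cauchy_schwarz.
Qed.

Lemma eq_geometric x y (C r : R) : 0 <= r < 1 ->
  (forall n, nrm (x - y) <= C * r ^+ n) -> x = y.
Proof.
move=> r01 h; apply/eqP; rewrite -subr_eq0; apply/eqP/nrm_eq0/eqP.
rewrite eq_le nrm_ge0 andbT; apply: (le_geometric r01 (C := C)) => n.
by rewrite add0r.
Qed.

(** The form in which completeness of a Hilbert space is used below: the explicit error
    bound makes it possible to transfer identities to the limit. *)
Lemma cvg_geometric (u : nat -> H) (C r : R) : 0 <= r < 1 ->
  (forall n, nrm (u n.+1 - u n) <= C * r ^+ n) ->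
  exists l, forall n, nrm (u n - l) <= C / (1 - r) * r ^+ n.
Proof.
move=> r01; have /andP[r0 r1] := r01; move=> h.
have r'0 : 0 < 1 - r by lra.
have C0 : 0 <= C by have := h 0; rewrite expr0 mulr1; apply: le_trans; exact: nrm_ge0.
pose D := C / (1 - r).
have D0 : 0 <= D by rewrite divr_ge0// ltW.
have DC : C = D * (1 - r) by rewrite /D divfK// gt_eqF.
have bnd m n : nrm (u (n + m)%N - u n) <= D * r ^+ n * (1 - r ^+ m).
  elim: m => [|m ih]; first by rewrite addn0 subrr nrm0 expr0 subrr mulr0.
  apply: le_trans (nrm_tri _ (u (n + m)%N) _) _.
  rewrite addnS; have := h (n + m)%N; rewrite exprD exprS DC; nra.
have bnd' m n : (n <= m)%N -> nrm (u m - u n) <= D * r ^+ n.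
  move=> nm; rewrite -(subnKC nm); apply: le_trans (bnd _ _) _.
  by apply: ler_piMr; [rewrite mulr_ge0 ?exprn_ge0|rewrite gerBl exprn_ge0].
have /cauchy_cvg/cvg_ex[l ul] : cauchy (u @ \oo).
  apply/cauchyP => e e0.
  have eE : e = (complex.Re e)%:C by rewrite RRe_real// gtr0_real.
  have e'0 : 0 < complex.Re e by rewrite -ltcR -eE.
  have [n hn] := geometric_small D r01 e'0.
  exists (u n); exists n => // m /= nm.
  rewrite -ball_normE /= normE eE ltcR nrmBC.
  exact: le_lt_trans (bnd' _ _ nm) hn.
exists l => n; rewrite -/D; apply/ler_addgt0Pr => e e0.
have /cvgrPdist_lt /(_ e%:C) := ul; rewrite ltcR => /(_ e0) [m _ hm].
apply: le_trans (nrm_tri _ (u (maxn n m)) _) _; apply: lerD.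
  by rewrite nrmBC; apply: bnd'; exact: leq_maxl.
have /= := hm (maxn n m) (leq_maxr _ _).
by rewrite normE ltcR nrmBC => /ltW.
Qed.

End hilbert.

(** * Bounded maps, Riesz representation and adjoints *)

Section linear_maps.
Context {R : realType} {H K : hilbertType R}.
Variable T : H -> K.
Hypothesis linT : linear T.

Lemma linD x y : T (x + y) = T x + T y.
Proof. by have := linT 1 x y; rewrite !scale1r. Qed.

Lemma lin0 : T 0 = 0.
Proof. by have := linD 0 0; rewrite addr0 => /eqP; rewrite -subr_eq subrr eq_sym => /eqP. Qed.

Lemma linZ (a : R[i]) x : T (a *: x) = a *: T x.
Proof. by have := linT a x 0; rewrite lin0 !addr0. Qed.

Lemma linN x : T (- x) = - T x.
Proof. by rewrite -scaleN1r linZ scaleN1r. Qed.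

Lemma linB x y : T (x - y) = T x - T y.
Proof. by rewrite linD linN. Qed.

Definition linE := (linD, linN, linZ, lin0).

End linear_maps.

Section bounded_maps.
Context {R : realType} {H : hilbertType R}.

Lemma bounded_opP (T : H -> H) : bounded_op T <->
  linear T /\ exists2 M : R, 0 <= M & forall x, nrm (T x) <= M * nrm x.
Proof.
split=> -[linT [M]] => [hM|M0 hM]; split=> //.
  exists `|M| => // x; have := hM x; rewrite !normE -rmorphM lecR => h.
  apply: le_trans h _; apply: ler_wpM2r; [exact: nrm_ge0|exact: ler_norm].
by exists M => x; rewrite !normE -rmorphM lecR.
Qed.

Lemma linear_comp (K L : hilbertType R) (T : K -> L) (S : H -> K) :
  linear T -> linear S -> linear (T \o S).
Proof. by move=> lT lS a x y /=; rewrite lS lT. Qed.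

End bounded_maps.

Section riesz.
Context {R : realType} {H : hilbertType R}.

(** The representing vector minimises [q x = |x|^2 - 2 phi x].  By the
    parallelogram identity for [q] a minimising sequence with excess [4^-n] has
    increments of size [2^-n]; at its limit [y] the first variation
    [<x, y> - phi x] of [q] vanishes for every [x]. *)
Lemma riesz (phi : H -> R) (M : R) :
  {morph phi : x y / x + y} -> (forall (t : R) x, phi (t%:C *: x) = t * phi x) ->
  0 <= M -> (forall x, phi x <= M * nrm x) ->
  exists y, forall x, phi x = rdot x y.
Proof.
move=> phiD phiZ M0 phiM.
pose q x := nrm x ^+ 2 - 2 * phi x.
pose m := inf [set q x | x in setT].
have q_lb : has_inf [set q x | x in setT].
  split; first by exists (q 0); exists 0.
  exists (- M ^+ 2) => _ [x _ <-]; rewrite /q.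
  have := phiM x; have : 0 <= (nrm x - M) ^+ 2 by exact: sqr_ge0.
  rewrite sqrrB; lra.
have mq x : m <= q x by apply: ge_inf; [exact: q_lb.2|exists x].
have near_min n : exists x, q x <= m + (4^-1) ^+ n.
  have e0 : 0 < (4^-1 : R) ^+ n by rewrite exprn_gt0// invr_gt0.
  have [_ [x _ <-] h] := inf_adherent e0 q_lb.
  by exists x; exact: ltW.
have [u hu] := choice near_min.
pose h2 : R := 2^-1.
have h2r : 0 <= h2 < 1 by rewrite /h2 invr_ge0 ler0n /= invf_lt1// ltr1n.
have h22 n : (4^-1 : R) ^+ n = (h2 ^+ n) ^+ 2.
  by rewrite exprAC; congr (_ ^+ _); rewrite /h2; field.
have par x y : nrm (x - y) ^+ 2 = 2 * q x + 2 * q y - 4 * q (h2%:C *: (x + y)).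
  by rewrite /q !nrm_sqr phiZ phiD !rdotE (rdotC y x) /h2; field.
have ustep n : nrm (u n.+1 - u n) <= 2 * h2 ^+ n.
  have p0 : 0 <= h2 ^+ n by rewrite exprn_ge0// (andP h2r).1.
  rewrite -ler_sqr ?nnegrE ?nrm_ge0 ?mulr_ge0// par.
  have := hu n; have := hu n.+1; have := mq (h2%:C *: (u n.+1 + u n)).
  rewrite exprS h22 exprMn; nra.
have [y hy] := cvg_geometric h2r ustep; exists y => x.
pose D := rdot x y - phi x.
have ineq t : 0 <= 2 * t * D + t ^+ 2 * nrm x ^+ 2.
  have Cle : exists C, forall n, 0 <= 2 * t * D + t ^+ 2 * nrm x ^+ 2 + C * h2 ^+ n.
    exists (1 + 2 * `|t| * (nrm x * (2 / (1 - h2)))) => n.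
    have p0 : 0 <= h2 ^+ n by rewrite exprn_ge0// (andP h2r).1.
    have p1 : h2 ^+ n <= 1 by rewrite exprn_ile1 ?(andP h2r).1// ltW ?(andP h2r).2.
    have := mq (u n + t%:C *: x); have := hu n.
    rewrite h22 /q phiD phiZ !nrm_sqr !rdotE => h1 h3.
    have cs : t * rdot x (u n - y) <= `|t| * (nrm x * (2 / (1 - h2) * h2 ^+ n)).
      apply: le_trans (ler_norm _) _; rewrite normrM ler_wpM2l//.
      apply: le_trans (abs_cauchy_schwarz _ _) _.
      by rewrite ler_wpM2l ?nrm_ge0// hy.
    have p2 : (h2 ^+ n) ^+ 2 <= h2 ^+ n by rewrite expr2 ler_piMl.
    move: cs h3; rewrite rdotDr rdotNr /D (rdotC (u n) x); lra.
  have [C hC] := Cle; exact: (le_geometric h2r hC).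
(* nearly the minimiser of the quadratic; adding 1 avoids the case x = 0 *)
have := ineq (- D / (nrm x ^+ 2 + 1)).
set N := nrm x ^+ 2; have N0 : 0 <= N by exact: sqr_ge0.
have N1 : N + 1 != 0 by rewrite gt_eqF//; lra.
have -> : 2 * (- D / (N + 1)) * D + (- D / (N + 1)) ^+ 2 * N =
   - (D ^+ 2 * (N + 2)) / (N + 1) ^+ 2 by field.
rewrite pmulr_lge0 ?invr_gt0 ?exprn_gt0//; last lra.
move=> h; have : D ^+ 2 = 0 by have := sqr_ge0 D; nra.
by move/eqP; rewrite sqrf_eq0 /D subr_eq0 => /eqP.
Qed.

End riesz.

Section adjoint.
Context {R : realType} {H K : hilbertType R}.

Lemma adjoint_exists (T : H -> K) (M : R) : linear T -> 0 <= M ->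
  (forall x, nrm (T x) <= M * nrm x) ->
  exists T' : K -> H, [/\ linear T', forall x y, '[T x, y] = '[x, T' y]
    & forall y, nrm (T' y) <= M * nrm y].
Proof.
move=> linT M0 TM.
have ex y : exists z, forall x, rdot (T x) y = rdot x z.
  apply: (@riesz _ _ (fun x => rdot (T x) y) (M * nrm y)).
  - by move=> a b; rewrite linD// rdotDl.
  - by move=> t a; rewrite linZ// rdotZl.
  - by rewrite mulr_ge0 ?nrm_ge0.
  - move=> x; apply: le_trans (cauchy_schwarz _ _) _.
    by rewrite mulrAC ler_wpM2r ?nrm_ge0.
have [T' hT'] := choice ex.
have adj x y : '[T x, y] = '[x, T' y] by rewrite !inner_rdotE -linZ// !hT'.
exists T'; split=> //.
- move=> a x y; apply: inner_ext => z.
  by rewrite -adj !(innerDr, innerZr) -!adj.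
- move=> y; have [/nrm_eq0 ->|n0] := eqVneq (nrm (T' y)) 0.
    by rewrite nrm0 mulr_ge0 ?nrm_ge0.
  have p : 0 < nrm (T' y) by rewrite lt_neqAle eq_sym n0 nrm_ge0.
  rewrite -(ler_pM2l p) -expr2 nrm_sqr -hT'.
  apply: le_trans (cauchy_schwarz _ _) _.
  by rewrite mulrA ler_wpM2r ?nrm_ge0// mulrC TM.
Qed.

End adjoint.

(** * Coercive operators are invertible *)

Section lax_milgram.
Context {R : realType} {H : hilbertType R}.

(** Lax-Milgram theorem.  For small [rho] the map [x |-> x - rho (T x - b)] is a
    contraction, and its fixed point solves [T x = b]. *)
Lemma coercive_invertible (T : H -> H) (d : R) : bounded_op T -> 0 < d ->
  (forall x, d * nrm x ^+ 2 <= rdot (T x) x) ->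
  exists S, [/\ bounded_op S, cancel T S & cancel S T].
Proof.
move=> /bounded_opP[linT [M0 M00 TM0]] d0 coerc.
(* M >= d is needed for the squared contraction factor r2 to be nonnegative *)
pose M := M0 + d.
have M_gt0 : 0 < M by rewrite /M; lra.
have TM x : nrm (T x) <= M * nrm x.
  by apply: le_trans (TM0 x) _; rewrite ler_wpM2r ?nrm_ge0// /M; lra.
(* the minimiser of 1 - 2 rho d + rho^2 M^2 *)
pose rho := d / M ^+ 2.
have rho_gt0 : 0 < rho by rewrite divr_gt0// exprn_gt0.
pose r2 := 1 - rho * d.
have r2_ge0 : 0 <= r2.
  rewrite /r2 /rho subr_ge0 mulrAC ler_pdivrMr ?exprn_gt0// mul1r -expr2.
  by rewrite ler_sqr ?nnegrE ?(ltW d0) ?(ltW M_gt0)// /M; lra.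
have r2_lt1 : r2 < 1 by rewrite /r2; have := mulr_gt0 rho_gt0 d0; lra.
pose r := Num.sqrt r2.
have r01 : 0 <= r < 1.
  by rewrite sqrtr_ge0/= -sqrtr1 ltr_sqrt.
have contr x : nrm (x - rho%:C *: T x) <= r * nrm x.
  rewrite -ler_sqr ?nnegrE ?nrm_ge0 ?mulr_ge0 ?nrm_ge0 ?sqrtr_ge0//.
  rewrite exprMn sqr_sqrtr// [X in X <= _]nrm_sqr !rdotE -!nrm_sqr (rdotC x).
  have h1 := coerc x.
  have h2 : nrm (T x) ^+ 2 <= M ^+ 2 * nrm x ^+ 2.
    by rewrite -exprMn ler_sqr ?nnegrE ?nrm_ge0 ?mulr_ge0 ?nrm_ge0 ?(ltW M_gt0).
  have h3 : rho ^+ 2 * nrm (T x) ^+ 2 <= rho * d * nrm x ^+ 2.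
    have -> : rho * d * nrm x ^+ 2 = rho ^+ 2 * (M ^+ 2 * nrm x ^+ 2).
      by rewrite /rho; field; rewrite gt_eqF.
    by rewrite ler_wpM2l ?sqr_ge0.
  rewrite /r2; nra.
have below x : nrm x <= d^-1 * nrm (T x).
  have [/nrm_eq0 ->|n0] := eqVneq (nrm x) 0.
    by rewrite nrm0 mulr_ge0 ?nrm_ge0// invr_ge0 ltW.
  have p : 0 < nrm x by rewrite lt_neqAle eq_sym n0 nrm_ge0.
  rewrite ler_pdivlMl// -(ler_pM2r p) -mulrA -expr2.
  exact: le_trans (coerc x) (cauchy_schwarz _ _).
have surj b : exists x, T x = b.
  have [u uS] : exists u : nat -> H,
      forall n, u n.+1 = u n - rho%:C *: (T (u n) - b).
    by exists (fun n => iter n (fun v => v - rho%:C *: (T v - b)) 0) => n; rewrite iterS.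
  have step n : u n.+1 - u n = - (rho%:C *: (T (u n) - b)) by rewrite uS addrC addKr.
  have ustep n : nrm (u n.+1 - u n) <= nrm (u 1%N - u 0%N) * r ^+ n.
    elim: n => [|n ih]; first by rewrite expr0 mulr1.
    have -> : u n.+2 - u n.+1 = (u n.+1 - u n) - rho%:C *: T (u n.+1 - u n).
      rewrite (step n.+1) (linB linT) (step n) -!scalerN -scalerDr; congr (_ *: _).
      by rewrite !opprB [RHS]addrA subrK.
    by apply: le_trans (contr _) _; rewrite exprS mulrCA ler_wpM2l ?(andP r01).1.
  have [l hl] := cvg_geometric r01 ustep.
  set C := _ / _ in hl.
  exists l; apply: (eq_geometric r01 (C := M * C + nrm (u 1%N - u 0%N) / rho)) => n.
  apply: le_trans (nrm_tri _ (T (u n)) _) _; rewrite mulrDl; apply: lerD.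
    rewrite nrmBC -(linB linT) -mulrA; apply: le_trans (TM _) _.
    by rewrite ler_wpM2l ?(ltW M_gt0).
  rewrite mulrAC ler_pdivlMr//; apply: le_trans (ustep n).
  by rewrite step nrmN nrmZr gtr0_norm// mulrC.
have [S TS] := choice surj.
have ST : cancel T S.
  move=> x; apply/eqP; rewrite -subr_eq0; apply/eqP/nrm_eq0/eqP.
  rewrite eq_le nrm_ge0 andbT; apply: le_trans (below _) _.
  by rewrite (linB linT) TS subrr nrm0 mulr0.
exists S; split=> //; apply/bounded_opP; split.
  by move=> a x y; apply: (can_inj ST); rewrite TS linT !TS.
by exists d^-1; [rewrite invr_ge0 ltW|move=> x; rewrite -{2}(TS x)].
Qed.

End lax_milgram.

(** * Positive operators and their square roots *)

Section positive_maps.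
Context {R : realType} {H : hilbertType R}.
Implicit Types (x y : H) (P : H -> H).

Definition symmetric_map P := forall x y, '[P x, y] = '[x, P y].

Lemma sym_rdot P : symmetric_map P -> forall x y, rdot (P x) y = rdot x (P y).
Proof. by move=> h x y; rewrite /rdot h. Qed.

Lemma rdot_sym P : linear P -> (forall x y, rdot (P x) y = rdot x (P y)) ->
  symmetric_map P.
Proof. by move=> lP h x y; rewrite inner_rdotE -(linZ lP) !h -inner_rdotE. Qed.

(** [<P z, z> >= 0] for [z = x - t P x] is a quadratic inequality in [t]; it is
    used at [t = 1 / M], or at [t = 1] when [M = 0]. *)
Lemma pos_sqr_le P (M : R) x : linear P -> symmetric_map P -> 0 <= M ->
  (forall z, 0 <= rdot (P z) z <= M * nrm z ^+ 2) ->
  nrm (P x) ^+ 2 <= M * rdot (P x) x.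
Proof.
move=> lP sP M0 h.
have q t : 0 <= rdot (P x) x - 2 * t * nrm (P x) ^+ 2 + t ^+ 2 * (M * nrm (P x) ^+ 2).
  have /andP[h1 _] := h (x - t%:C *: P x).
  have /andP[_ h2] := h (P x).
  move: h1; rewrite (linB lP) (linZ lP) !rdotE (sym_rdot sP (P x) x) nrm_sqr => h1.
  have := ler_wpM2l (sqr_ge0 t) h2; rewrite nrm_sqr; lra.
have [M00|Mn0] := eqVneq M 0.
  have := q 1; have /andP[h1] := h x; rewrite M00 !mul0r => h2; lra.
have Mp : 0 < M by rewrite lt_neqAle eq_sym Mn0.
have := q M^-1.
have -> : M^-1 ^+ 2 * (M * nrm (P x) ^+ 2) = M^-1 * nrm (P x) ^+ 2 by field.
move=> h1; rewrite -ler_pdivrMl//; lra.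
Qed.

Lemma pos_norm_le P (M : R) x : linear P -> symmetric_map P -> 0 <= M ->
  (forall z, 0 <= rdot (P z) z <= M * nrm z ^+ 2) ->
  nrm (P x) <= M * nrm x.
Proof.
move=> lP sP M0 h; rewrite -ler_sqr ?nnegrE ?nrm_ge0 ?mulr_ge0 ?nrm_ge0//.
apply: le_trans (pos_sqr_le x lP sP M0 h) _.
by rewrite exprMn (expr2 M) -mulrA ler_wpM2l// (andP (h x)).2.
Qed.

(** [|x| = |S P x| <= N |P x|], and [|P x|^2 <= M <P x, x>] by [pos_sqr_le]. *)
Lemma pos_invertible_coercive P S (M : R) : linear P -> symmetric_map P ->
  0 < M -> (forall z, 0 <= rdot (P z) z <= M * nrm z ^+ 2) ->
  bounded_op S -> cancel P S ->
  exists2 d, 0 < d & forall x, d * nrm x ^+ 2 <= rdot (P x) x.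
Proof.
move=> lP sP M0 h /bounded_opP[_ [N N0 SN]] PS.
pose N' := N + 1; have N'0 : 0 < N' by rewrite /N'; lra.
exists ((M * N' ^+ 2)^-1) => [|x]; first by rewrite invr_gt0 mulr_gt0// exprn_gt0.
rewrite ler_pdivrMl ?mulr_gt0 ?exprn_gt0// mulrAC.
have := pos_sqr_le x lP sP (ltW M0) h.
have : nrm x ^+ 2 <= N' ^+ 2 * nrm (P x) ^+ 2.
  rewrite -exprMn ler_sqr ?nnegrE ?mulr_ge0 ?nrm_ge0 ?(ltW N'0)//.
  rewrite -{1}(PS x); apply: le_trans (SN _) _.
  by rewrite ler_wpM2r ?nrm_ge0// /N'; lra.
move=> h1 h2; apply: le_trans h1 _.
by rewrite mulrC ler_wpM2r ?sqr_ge0.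
Qed.

(** The square root of [1 - X], where [0 <= X <= 1 - s^2], is [1 - L] with [L]
    the solution of [L = (X + L^2) / 2].  The iteration [Y n] for this fixed
    point equation stays in the ball of radius [r = 1 - s], because
    [(1 - s^2 + r^2) / 2 = r], and there it contracts by the factor [r]. *)
Section square_root.
Variables (X : H -> H) (s : R).
Hypotheses (s01 : 0 < s <= 1) (linX : linear X) (symX : symmetric_map X).
Hypothesis Xbnd : forall z, 0 <= rdot (X z) z <= (1 - s ^+ 2) * nrm z ^+ 2.

Let r := 1 - s.
Let half : R := 2^-1.

Let Y n : H -> H := iter n (fun Z x => half%:C *: (X x + Z (Z x))) (fun=> 0).

Let YS n x : Y n.+1 x = half%:C *: (X x + Y n (Y n x)).
Proof. by []. Qed.

Let r01 : 0 <= r < 1. Proof. by case/andP: s01 => ? ?; apply/andP; split; rewrite /r; lra. Qed.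

Let linY n : linear (Y n).
Proof.
elim: n => [|n ih] a x y; first by rewrite /Y/= scaler0 addr0.
rewrite !YS linX ih ih.
rewrite scalerA mulrC -scalerA -scalerDr; congr (_ *: _).
by rewrite scalerDr addrACA.
Qed.

Let X_le x : nrm (X x) <= (1 - s ^+ 2) * nrm x.
Proof. by case/andP: s01 => ? ?; apply: pos_norm_le => //; rewrite subr_ge0 exprn_ile1//; lra. Qed.

Let Y_le n x : nrm (Y n x) <= r * nrm x.
Proof.
elim: n x => [|n ih] x; first by rewrite /Y/= nrm0 mulr_ge0 ?nrm_ge0 ?(andP r01).1.
rewrite YS nrmZr ger0_norm ?invr_ge0// ler_pdivrMl//.
apply: le_trans (nrmD _ _) _.
have h1 := X_le x; have h2 := ih (Y n x).
have h3 := ler_wpM2l (andP r01).1 (ih x).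
move: h1 h2 h3; rewrite /r; lra.
Qed.

Let symY n : forall x y, rdot (Y n x) y = rdot x (Y n y).
Proof.
elim: n => [|n ih] x y; first by rewrite /Y/= [RHS]rdotC !rdot0l.
by rewrite !YS !rdotE (sym_rdot symX) !ih.
Qed.

Let Y_step n x : nrm (Y n.+1 x - Y n x) <= nrm x * r ^+ n.
Proof.
elim: n x => [|n ih] x.
  rewrite expr0 mulr1 -[Y 0 x]/(0 : H) subr0; apply: le_trans (Y_le _ _) _.
  by rewrite ler_piMl ?nrm_ge0 ?ltW ?(andP r01).2.
rewrite (YS n.+1) (YS n x) -scalerBr nrmZr ger0_norm ?invr_ge0// ler_pdivrMl//.
have -> : X x + Y n.+1 (Y n.+1 x) - (X x + Y n (Y n x)) =
    Y n.+1 (Y n.+1 x - Y n x) + (Y n.+1 (Y n x) - Y n (Y n x)).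
  by rewrite opprD addrACA subrr add0r (linB (linY n.+1)) subrKA.
apply: le_trans (nrmD _ _) _; rewrite mulr2n mulrDl mul1r; apply: lerD.
  apply: le_trans (Y_le _ _) _.
  by rewrite exprS mulrCA ler_wpM2l ?(andP r01).1.
apply: le_trans (ih _) _; rewrite exprS mulrA ler_wpM2r ?exprn_ge0 ?(andP r01).1//.
by rewrite mulrC.
Qed.

(** Every property is inherited from the polynomials [Y n] in [X], which
    approximate [L] strongly and with geometric error. *)
Lemma sqrt_1B : exists L : H -> H,
  [/\ linear L, symmetric_map L, forall x, nrm (L x) <= r * nrm x,
      forall x, L x + L x = X x + L (L x)
    & forall W : H -> H, bounded_op W -> (forall x, W (X x) = X (W x)) ->
        forall x, W (L x) = L (W x)].
Proof.
have [L hL] : exists L : H -> H,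
    forall x n, nrm (Y n x - L x) <= nrm x / (1 - r) * r ^+ n.
  have ex x := cvg_geometric r01 (Y_step^~ x).
  by have [L hL] := choice ex; exists L.
pose k := (1 - r)^-1.
have hL' x n : nrm (Y n x - L x) <= nrm x * k * r ^+ n by exact: hL.
have linL : linear L.
  move=> a x y.
  apply: (eq_geometric r01 (C := nrm (a *: x + y) * k + complex.Re `|a| * (nrm x * k) + nrm y * k)) => n.
  rewrite !mulrDl; apply: le_trans (nrm_tri _ (Y n (a *: x + y)) _) _.
  rewrite -addrA; apply: lerD; first by rewrite nrmBC.
  rewrite linY opprD addrACA -scalerBr; apply: le_trans (nrmD _ _) _.
  apply: lerD => //; by rewrite nrmZ -mulrA ler_wpM2l ?Re_norm_ge0.
have L_le x : nrm (L x) <= r * nrm x.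
  apply: (le_geometric r01 (C := nrm x * k)) => n.
  rewrite -[L x](subrK (Y n x)) addrC; apply: le_trans (nrmD _ _) _.
  by apply: lerD => //; rewrite nrmBC.
exists L; split => //.
- apply: rdot_sym => // x y.
  have half_sym u v : rdot (L u) v <= rdot u (L v).
    apply: (le_geometric r01 (C := nrm u * k * nrm v + nrm u * (nrm v * k))) => n.
    have -> : rdot (L u) v = rdot u (L v) + (rdot (L u - Y n u) v + rdot u (Y n v - L v)).
      by rewrite !rdotE symY; ring.
    rewrite lerD2l mulrDl; apply: lerD.
      apply: le_trans (cauchy_schwarz _ _) _.
      by rewrite mulrAC ler_wpM2r ?nrm_ge0// nrmBC.
    apply: le_trans (cauchy_schwarz _ _) _.
    by rewrite -!mulrA ler_wpM2l ?nrm_ge0// mulrA.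
  by apply/eqP; rewrite eq_le half_sym (rdotC x) (rdotC (L x)) half_sym.
- move=> x; apply: (eq_geometric r01 (C := 2 * r * (nrm x * k) + (r * (nrm x * k) + nrm (L x) * k))) => n.
  have -> : L x + L x - (X x + L (L x)) =
      2%:C *: (L x - Y n.+1 x) + (Y n (Y n x - L x) + (Y n (L x) - L (L x))).
    rewrite YS (linB (linY n)) subrKA scalerBr scalerA -rmorphM divff ?pnatr_eq0//.
    rewrite scale1r scale2.
    by rewrite !opprD !addrA addrNK.
  rewrite 2!(mulrDl _ _ (r ^+ n)); apply: le_trans (nrmD _ _) _; apply: lerD.
    rewrite nrmZr ger0_norm// -!mulrA ler_wpM2l// nrmBC.
    by have := hL' x n.+1; rewrite exprS; lra.
  apply: le_trans (nrmD _ _) _; apply: lerD => //.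
  apply: le_trans (Y_le _ _) _.
  by rewrite -mulrA ler_wpM2l ?(andP r01).1.
- move=> W /bounded_opP[lW [M M0 WM]] WX x.
  have WY n z : W (Y n z) = Y n (W z).
    elim: n z => [|n ih] z; first by rewrite /Y/= (lin0 lW).
    by rewrite !YS (linZ lW) (linD lW) WX !ih.
  apply: (eq_geometric r01 (C := M * (nrm x * k) + nrm (W x) * k)) => n.
  apply: le_trans (nrm_tri _ (W (Y n x)) _) _; rewrite mulrDl; apply: lerD.
    rewrite nrmBC -(linB lW) -mulrA; apply: le_trans (WM _) _.
    by rewrite ler_wpM2l.
  by rewrite WY.
Qed.

End square_root.

(** [T = B (1 - L)] where [1 - L] is the square root of [S / B^2 = 1 - X].  With
    [s = A / B] the bound [|L x| <= (1 - s) |x|] gives [T >= B s = A]. *)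
Lemma sqrt_op (S : H -> H) (A B : R) : 0 < A -> A <= B ->
  linear S -> symmetric_map S ->
  (forall x, A ^+ 2 * nrm x ^+ 2 <= rdot (S x) x <= B ^+ 2 * nrm x ^+ 2) ->
  exists T : H -> H,
  [/\ linear T, symmetric_map T, forall x, T (T x) = S x,
      forall x, A * nrm x ^+ 2 <= rdot (T x) x
    & forall W : H -> H, bounded_op W -> (forall x, W (S x) = S (W x)) ->
        forall x, W (T x) = T (W x)].
Proof.
move=> A0 AB lS sS bnd.
have B0 : 0 < B by lra.
have Bn0 : B != 0 by rewrite gt_eqF.
pose s := A / B.
have s01 : 0 < s <= 1 by rewrite /s divr_gt0//= ler_pdivrMr// mul1r.
pose b := B ^- 2.
pose X x := x - b%:C *: S x.
have lX : linear X.
  move=> a x y; rewrite /X lS scalerBr scalerDr opprD addrACA.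
  by rewrite !scalerA mulrC.
have sX : symmetric_map X.
  by apply: rdot_sym => // x y; rewrite /X !rdotE (sym_rdot sS).
have bX z : 0 <= rdot (X z) z <= (1 - s ^+ 2) * nrm z ^+ 2.
  have /andP[h1 h2] := bnd z; rewrite /X !rdotE -nrm_sqr.
  have b0 : 0 <= b by rewrite invr_ge0 sqr_ge0.
  have := ler_wpM2l b0 h1; have := ler_wpM2l b0 h2.
  have -> : b * (A ^+ 2 * nrm z ^+ 2) = s ^+ 2 * nrm z ^+ 2 by rewrite /b /s; field.
  have -> : b * (B ^+ 2 * nrm z ^+ 2) = nrm z ^+ 2 by rewrite /b; field.
  lra.
have [L [lL sL L_le Lsq Lcomm]] := sqrt_1B s01 lX sX bX.
pose T x := B%:C *: (x - L x).
have lT : linear T.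
  move=> a x y; rewrite /T lL scalerA (mulrC a) -scalerA -scalerDr; congr (_ *: _).
  by rewrite scalerBr opprD addrACA.
exists T; split => //.
- by apply: rdot_sym => // x y; rewrite /T !rdotE (sym_rdot sL).
- move=> x; rewrite /T (linZ lL) -scalerBr scalerA (linB lL).
  have -> : x - L x - (L x - L (L x)) = b%:C *: S x.
    have -> : x - L x - (L x - L (L x)) = x - (L x + L x) + L (L x).
      by rewrite !opprD opprK !addrA.
    by rewrite Lsq opprD addrA addrNK /X opprB addrC subrK.
  by rewrite scalerA -!rmorphM /b -expr2 divff ?expf_neq0// scale1r.
- move=> x; rewrite /T !rdotE -nrm_sqr.
  have := cauchy_schwarz (L x) x; have := ler_wpM2r (nrm_ge0 x) (L_le x).
  move=> h1 h2; have h3 := le_trans h2 h1.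
  have -> : A = B * s by rewrite /s mulrCA divff ?mulr1.
  rewrite -mulrA ler_pM2l//; move: h3; lra.
- move=> W bW WS x; have [lW _] := bW.
  rewrite /T (linZ lW) (linB lW) (Lcomm W)// => z.
  by rewrite /X (linB lW) (linZ lW) WS.
Qed.

End positive_maps.

(** * Sums of nonnegative families *)

Section nonneg_sums.
Context {R : realType} {I : choiceType}.
Implicit Types (f g : I -> R).

Definition summableR f : Prop :=
  (forall i, 0 <= f i) /\ (\esum_(i in [set: I]) (f i)%:E < +oo)%E.

Definition sumR f : R := fine (\esum_(i in [set: I]) (f i)%:E).

Lemma sumRE f : summableR f -> (\esum_(i in [set: I]) (f i)%:E = (sumR f)%:E)%E.
Proof.
move=> [f0 foo]; rewrite /sumR fineK// ge0_fin_numE//.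
by apply: esum_ge0 => i _; rewrite lee_fin.
Qed.

Lemma sumR_fset_le f (F : {fset I}) : summableR f -> \sum_(i <- F) f i <= sumR f.
Proof.
move=> sf; rewrite -lee_fin -sumRE//; apply: esum_ge; exists [set` F] => //.
by rewrite fsbig_finite//= set_fsetK sumEFin.
Qed.

Lemma sumR_le f (M : R) : (forall i, 0 <= f i) ->
  (forall F : {fset I}, \sum_(i <- F) f i <= M) -> summableR f /\ sumR f <= M.
Proof.
move=> f0 h.
have le : (\esum_(i in [set: I]) (f i)%:E <= M%:E)%E.
  apply: ge_ereal_sup => _ [F [finF _] <-].
  by rewrite fsbig_finite//= sumEFin lee_fin.
have sf : summableR f by split => //; apply: le_lt_trans le _; rewrite ltry.
by split=> //; rewrite -lee_fin -sumRE.
Qed.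

Lemma sumR_approx f (e : R) : summableR f -> 0 < e ->
  exists F : {fset I}, sumR f - e < \sum_(i <- F) f i.
Proof.
move=> sf e0; apply: contrapT => /forallNP h.
have [|_] := @sumR_le f (sumR f - e) sf.1; last lra.
by move=> F; rewrite leNgt; apply/negP; exact: h.
Qed.

Lemma sumR_ge0 f : summableR f -> 0 <= sumR f.
Proof.
move=> sf; have := sumR_fset_le fset0 sf.
by rewrite big_seq_fset0.
Qed.

Lemma sumR_ge f i : summableR f -> f i <= sumR f.
Proof.
by move=> sf; have := sumR_fset_le [fset i]%fset sf; rewrite big_seq_fset1.
Qed.

Lemma summableRD f g : summableR f -> summableR g -> summableR (fun i => f i + g i).
Proof.
move=> sf sg; split=> [i|]; first by rewrite addr_ge0 ?sf.1 ?sg.1.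
under eq_esum do rewrite EFinD.
rewrite esumD => [|i _|i _]; rewrite ?lee_fin ?sf.1 ?sg.1//.
by rewrite !sumRE// -EFinD ltry.
Qed.

Lemma sumRD f g : summableR f -> summableR g ->
  sumR (fun i => f i + g i) = sumR f + sumR g.
Proof.
move=> sf sg; rewrite {1}/sumR; under eq_esum do rewrite EFinD.
rewrite esumD => [|i _|i _]; rewrite ?lee_fin ?sf.1 ?sg.1//.
by rewrite !sumRE.
Qed.

Lemma summableR_le f g : (forall i, 0 <= f i <= g i) -> summableR g -> summableR f.
Proof.
move=> fg sg; have [] // := @sumR_le f (sumR g) (fun i => (andP (fg i)).1).
move=> F; apply: le_trans (sumR_fset_le F sg).
by apply: ler_sum => i _; case/andP: (fg i).
Qed.

Lemma sumR_leZ f (c : R) : 0 <= c -> summableR f ->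
  summableR (fun i => c * f i) /\ sumR (fun i => c * f i) <= c * sumR f.
Proof.
move=> c0 sf; apply: sumR_le => [i|F]; first by rewrite mulr_ge0// sf.1.
by rewrite -mulr_sumr ler_wpM2l// sumR_fset_le.
Qed.

Lemma summableRZ f (c : R) : 0 <= c -> summableR f -> summableR (fun i => c * f i).
Proof. by move=> c0 /(sumR_leZ c0)[]. Qed.

Lemma sumRZ f (c : R) : 0 <= c -> summableR f ->
  sumR (fun i => c * f i) = c * sumR f.
Proof.
move=> c0 sf; have [h1 h2] := sumR_leZ c0 sf.
apply/eqP; rewrite eq_le h2/=.
have [->|cn0] := eqVneq c 0; first by rewrite mul0r; apply: sumR_ge0; exact: summableRZ.
have cp : 0 < c by rewrite lt_neqAle eq_sym cn0.
have ci : 0 <= c^-1 by rewrite invr_ge0.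
rewrite -ler_pdivlMl//; have [_] := sumR_leZ ci h1.
by under eq_fun do rewrite mulrA mulVf// mul1r.
Qed.

Lemma sumR_supp1 f j : (forall i, 0 <= f i) -> (forall i, i != j -> f i = 0) ->
  summableR f /\ sumR f = f j.
Proof.
move=> f0 fj; have [|sf le] := @sumR_le f (f j) f0.
  move=> F; have [jF|jF] := boolP (j \in F).
    rewrite (big_fsetD1 j)//= big_seq big1 ?addr0// => i.
    by rewrite !inE => /andP[ij _]; exact: fj.
  rewrite big_seq big1// => i iF; apply: fj; apply: contraNneq jF => <-//.
by split=> //; apply/eqP; rewrite eq_le le sumR_ge.
Qed.

Lemma sumR_reindex f (p : I -> I) : bijective p -> summableR f ->
  summableR (f \o p) /\ sumR (f \o p) = sumR f.
Proof.
move=> bp sf.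
have bij : set_bij [set: I] [set: I] p by rewrite setTT_bijective.
have e : (\esum_(i in [set: I]) (f i)%:E = \esum_(i in [set: I]) ((f \o p) i)%:E)%E.
  exact: (reindex_esum setT setT p (fun i => (f i)%:E) bij).
split; last by rewrite /sumR e.
by split=> [i|]; [exact: sf.1|rewrite -e; exact: sf.2].
Qed.

End nonneg_sums.

(** * The Hilbert space of square summable families *)

Section sqn.
Context {R : realType}.
Implicit Types (z w : R[i]).

Definition sqn z : R := complex.Re z ^+ 2 + complex.Im z ^+ 2.

Lemma sqnE z : complex.Re (`|z| ^+ 2) = sqn z.
Proof. by rewrite -add_Re2_Im2. Qed.

Lemma sqn_ge0 z : 0 <= sqn z.
Proof. by rewrite addr_ge0 ?sqr_ge0. Qed.

Lemma sqn_eq0 z : sqn z = 0 -> z = 0.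
Proof.
case: z => a b; rewrite /sqn/= => /eqP; rewrite paddr_eq0 ?sqr_ge0//.
by rewrite !sqrf_eq0 => /andP[/eqP -> /eqP ->].
Qed.

Lemma sqnM z w : sqn (z * w) = sqn z * sqn w.
Proof. by case: z w => a b [c d]; rewrite /sqn/=; ring. Qed.

Lemma sqnD_le z w : sqn (z + w) <= 2 * sqn z + 2 * sqn w.
Proof.
case: z w => a b [c d]; rewrite /sqn/=.
have := sqr_ge0 (a - c); have := sqr_ge0 (b - d); lra.
Qed.

Lemma sqnN z : sqn (- z) = sqn z.
Proof. by case: z => a b; rewrite /sqn/= !sqrrN. Qed.

Lemma sqn0 : sqn 0 = 0.
Proof. by rewrite /sqn/= expr0n addr0. Qed.

End sqn.

Section l2_type.
Context {R : realType} {I : choiceType}.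

Definition l2_pred : {pred I -> R[i]} :=
  fun x => (\esum_(i in [set: I]) (sqn (x i))%:E < +oo)%E.

Lemma l2_predP (x : I -> R[i]) : reflect (summableR (fun i => sqn (x i))) (x \in l2_pred).
Proof. by apply: (iffP idP) => [h|[]//]; split=> // i; exact: sqn_ge0. Qed.

Lemma l2_zmod_closed : zmod_closed l2_pred.
Proof.
split.
  apply/l2_predP; have [] // := @sumR_le R I (fun i => sqn ((0 : I -> R[i]) i)) 0.
    by move=> i; exact: sqn_ge0.
  by move=> F; rewrite big1// => i _; exact: sqn0.
move=> x y /l2_predP sx /l2_predP sy; apply/l2_predP.
have two : 0 <= 2 :> R by [].
apply: summableR_le (summableRD (summableRZ two sx) (summableRZ two sy)) => i.
rewrite sqn_ge0 /=; apply: le_trans (sqnD_le (x i) (- y i)) _.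
by rewrite sqnN.
Qed.

HB.instance Definition _ := GRing.isZmodClosed.Build (I -> R[i]) l2_pred l2_zmod_closed.

Record l2 : Type := L2 { l2fun :> I -> R[i]; l2P : l2fun \in l2_pred }.

HB.instance Definition _ := [isSub for l2fun].
HB.instance Definition _ := [Choice of l2 by <:].
HB.instance Definition _ := [SubChoice_isSubZmodule of l2 by <:].

Lemma l2_ext (x y : l2) : (forall i, x i = y i) -> x = y.
Proof. by move=> h; apply/val_inj/funext. Qed.

Lemma l2D (x y : l2) i : (x + y) i = x i + y i. Proof. by []. Qed.
Lemma l2N (x : l2) i : (- x) i = - x i. Proof. by []. Qed.

Lemma l2_summable (x : l2) : summableR (fun i => sqn (x i)).
Proof. exact/l2_predP/l2P. Qed.

Lemma l2_scale_subproof (a : R[i]) (x : l2) : (fun i => a * x i) \in l2_pred.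
Proof.
apply/l2_predP; under [X in summableR X]eq_fun do rewrite sqnM.
exact: summableRZ (sqn_ge0 _) (l2_summable x).
Qed.

Definition l2_scale (a : R[i]) (x : l2) : l2 := L2 (l2_scale_subproof a x).

Lemma l2_scaleA a b (x : l2) : l2_scale a (l2_scale b x) = l2_scale (a * b) x.
Proof. by apply: l2_ext => i /=; rewrite mulrA. Qed.

Lemma l2_scale1 : left_id 1 l2_scale.
Proof. by move=> x; apply: l2_ext => i /=; rewrite mul1r. Qed.

Lemma l2_scaleDr : right_distributive l2_scale +%R.
Proof. by move=> a x y; apply: l2_ext => i; exact: mulrDr. Qed.

Lemma l2_scaleDl (x : l2) : {morph l2_scale^~ x : a b / a + b}.
Proof. by move=> a b; apply: l2_ext => i; exact: mulrDl. Qed.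

HB.instance Definition _ := GRing.Zmodule_isLmodule.Build R[i] l2
  l2_scaleA l2_scale1 l2_scaleDr l2_scaleDl.

Lemma l2Z (a : R[i]) (x : l2) i : (a *: x) i = a * x i. Proof. by []. Qed.

End l2_type.
Arguments l2 : clear implicits.

Section l2_inner.
Context {R : realType} {I : choiceType}.
Local Notation l2 := (l2 R I).
Implicit Types (x y z : l2) (t : R) (a : R[i]).

Definition l2sq x : R := sumR (fun i => sqn (x i)).

Lemma l2sq_ge0 x : 0 <= l2sq x.
Proof. exact: sumR_ge0 (l2_summable x). Qed.

Lemma l2sq_ge x i : sqn (x i) <= l2sq x.
Proof. exact: (sumR_ge i (l2_summable x)). Qed.

Lemma l2sqZ a x : l2sq (a *: x) = sqn a * l2sq x.
Proof.
rewrite /l2sq -sumRZ; [|exact: sqn_ge0|exact: l2_summable].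
by congr sumR; apply/funext => i; rewrite l2Z sqnM.
Qed.

Lemma l2sq_eq0 x : l2sq x = 0 -> x = 0.
Proof.
move=> h; apply: l2_ext => i; apply: sqn_eq0; apply/eqP.
by rewrite eq_le sqn_ge0 -{1}h l2sq_ge.
Qed.

(** The inner product is defined by polarisation, without complex-valued sums.
    Its algebraic laws follow by summing pointwise identities between
    nonnegative terms. *)
Definition l2re x y : R := (l2sq (x + y) - l2sq x - l2sq y) / 2.

Lemma l2reC x y : l2re x y = l2re y x.
Proof. by rewrite /l2re (addrC x) addrAC. Qed.

(** Sum of [|a + b + c|^2 + |a|^2 + |b|^2 + |c|^2 =
    |a + b|^2 + |a + c|^2 + |b + c|^2]. *)
Lemma l2reDl x y z : l2re (x + y) z = l2re x z + l2re y z.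
Proof.
have : l2sq (x + y + z) + (l2sq x + (l2sq y + l2sq z)) =
       l2sq (x + y) + (l2sq (x + z) + l2sq (y + z)).
  rewrite /l2sq -!sumRD; do ?[exact: l2_summable | apply: summableRD].
  congr sumR; apply/funext => i; rewrite !l2D.
  by case: (x i) (y i) (z i) => a b [c d] [e f]; rewrite /sqn/=; ring.
rewrite /l2re; lra.
Qed.

Lemma l2reNl x y : l2re (- x) y = - l2re x y.
Proof.
have l2re0 : l2re 0 y = 0 by have := l2reDl 0 0 y; rewrite addr0; lra.
have := l2reDl x (- x) y; rewrite subrr l2re0; lra.
Qed.

(** Sum of [|t a + b|^2 + t |a|^2 + t |b|^2 = t |a + b|^2 + t^2 |a|^2 + |b|^2],
    all of whose terms are nonnegative when [t >= 0]. *)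
Lemma l2reZl t x y : l2re (t%:C *: x) y = t * l2re x y.
Proof.
wlog t0 : t / 0 <= t => [h|].
  have [/h//|/ltW t0] := leP 0 t.
  rewrite -[t]opprK rmorphN scaleNr l2reNl h ?oppr_ge0//; ring.
have tE : sqn (t%:C) = t ^+ 2 by rewrite /sqn/= expr0n addr0.
have : l2sq (t%:C *: x + y) + (t * l2sq x + t * l2sq y) =
       t * l2sq (x + y) + (t ^+ 2 * l2sq x + l2sq y).
  rewrite /l2sq -!sumRZ ?sqr_ge0//; do ?[exact: l2_summable].
  rewrite -!sumRD; do ?[exact: l2_summable | apply: summableRD | apply: summableRZ | exact: t0 | exact: sqr_ge0].
  congr sumR; apply/funext => i; rewrite !l2D l2Z.
  by case: (x i) (y i) => a b [c d]; rewrite /sqn/=; ring.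
rewrite /l2re l2sqZ tE; lra.
Qed.

Lemma l2re_sq x : l2re x x = l2sq x.
Proof.
rewrite /l2re (_ : x + x = (2 : R)%:C *: x).
  by rewrite l2sqZ /sqn/=; field.
by rewrite -[2]/(1 + 1) rmorphD/= scalerDl scale1r.
Qed.

Lemma l2reI x y : l2re ('i%C *: x) ('i%C *: y) = l2re x y.
Proof. by rewrite /l2re -scalerDr !l2sqZ /sqn/= expr0n expr1n add0r !mul1r. Qed.

Lemma scaleII x : 'i%C *: ('i%C *: x) = - x.
Proof. by rewrite scalerA -expr2 sqr_i scaleN1r. Qed.

Lemma l2reIl x y : l2re ('i%C *: x) y = - l2re x ('i%C *: y).
Proof. by rewrite -l2reI scaleII l2reNl. Qed.

(** [Re <x, i y> = Im <x, y>] for a form that is conjugate-linear on the right. *)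
Definition l2dot x y : R[i] := l2re x y +i* l2re x ('i%C *: y).

Lemma l2dotDl x y z : l2dot (x + y) z = l2dot x z + l2dot y z.
Proof. by rewrite /l2dot !l2reDl. Qed.

Lemma l2dotC x y : l2dot x y = (l2dot y x)^*%C.
Proof. by rewrite /l2dot /= (l2reC y x) (l2reC y ('i%C *: x)) l2reIl opprK. Qed.

Lemma l2dotZl a x y : l2dot (a *: x) y = a * l2dot x y.
Proof.
have -> : a *: x = (complex.Re a)%:C *: x + (complex.Im a)%:C *: ('i%C *: x).
  by rewrite scalerA -scalerDl {1}(complexE a) [X in _ + X]mulrC.
rewrite /l2dot !l2reDl !l2reZl l2reI l2reIl.
by case: a => p q /=; congr (_ +i* _); ring.
Qed.

Lemma l2dotBl z : zmod_morphism (l2dot^~ z).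
Proof.
by move=> x y; rewrite l2dotDl -scaleN1r l2dotZl mulN1r.
Qed.

Lemma l2dotBr z : zmod_morphism (l2dot z).
Proof.
by move=> x y; rewrite [LHS]l2dotC l2dotBl rmorphB (l2dotC z x) (l2dotC z y).
Qed.

Lemma l2dotZr z : scalable_for (Num.conj \; *%R) (l2dot z).
Proof. by move=> a x; rewrite [LHS]l2dotC l2dotZl rmorphM (l2dotC z x). Qed.

Lemma l2dot_sq x : l2dot x x = (l2sq x)%:C.
Proof.
rewrite /l2dot l2re_sq; congr (_ +i* _).
by have := l2reIl x x; rewrite l2reC; lra.
Qed.

Lemma l2dot_gt0 x : x != 0 -> 0 < l2dot x x.
Proof.
move=> x0; rewrite l2dot_sq ltcR lt_neqAle l2sq_ge0 andbT eq_sym.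
by apply: contra_neq x0; exact: l2sq_eq0.
Qed.

HB.instance Definition _ := @isBilinear.Build R[i] l2 l2 R[i] *%R (Num.conj \; *%R) l2dot
  l2dotBl l2dotBr (fun z a x => l2dotZl a x z) l2dotZr.

Lemma l2dot_herm x y : l2dot x y = (-1) ^+ false * Num.conj (l2dot y x).
Proof. by rewrite expr0 mul1r l2dotC. Qed.

HB.instance Definition _ := isHermitianSesquilinear.Build R[i] l2 false Num.conj l2dot l2dot_herm.
HB.instance Definition _ := isDotProduct.Build R[i] l2 l2dot l2dot_gt0.

Definition l2norm x : R[i] := (Num.sqrt (l2sq x))%:C.

Lemma l2re_le x y : l2re x y <= Num.sqrt (l2sq x) * Num.sqrt (l2sq y).
Proof.
set a := Num.sqrt _; set b := Num.sqrt _.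
have a2 : l2sq x = a ^+ 2 by rewrite sqr_sqrtr ?l2sq_ge0.
have b2 : l2sq y = b ^+ 2 by rewrite sqr_sqrtr ?l2sq_ge0.
have a0 : 0 <= a by exact: sqrtr_ge0.
have b0 : 0 <= b by exact: sqrtr_ge0.
have [ab|ab] := eqVneq (a * b) 0.
  move/eqP: ab; rewrite mulf_eq0 => /orP[] /eqP e.
    have -> : x = 0 by apply: l2sq_eq0; rewrite a2 e expr0n.
    by rewrite -(scaler0 _ (0 : R)%:C) l2reZl mul0r mulr_ge0.
  have -> : y = 0 by apply: l2sq_eq0; rewrite b2 e expr0n.
  by rewrite l2reC -(scaler0 _ (0 : R)%:C) l2reZl mul0r mulr_ge0.
have p : 0 < a * b by rewrite lt_neqAle eq_sym ab mulr_ge0.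
have := l2sq_ge0 (b%:C *: x - a%:C *: y).
rewrite -l2re_sq l2reDl !(l2reC _ (_ - _)) !l2reDl -!scaleNr -!rmorphN !l2reZl.
rewrite !(l2reC _ (_ *: _)) !l2reZl (l2reC y x) !l2re_sq a2 b2 => h.
rewrite -(ler_pM2l p); lra.
Qed.

Lemma l2norm_triangle x y : l2norm (x + y) <= l2norm x + l2norm y.
Proof.
rewrite /l2norm -rmorphD lecR.
rewrite -ler_sqr ?nnegrE ?addr_ge0 ?sqrtr_ge0// sqr_sqrtr ?l2sq_ge0//.
rewrite sqrrD !sqr_sqrtr ?l2sq_ge0//.
have := l2re_le x y; rewrite {1}/l2re -mulr_natr; lra.
Qed.

Lemma l2normZ a x : l2norm (a *: x) = `|a| * l2norm x.
Proof. by rewrite /l2norm l2sqZ sqrtrM ?sqn_ge0// rmorphM/= normc_def. Qed.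

Lemma l2norm_eq0 x : l2norm x = 0 -> x = 0.
Proof.
move=> [h]; apply: l2sq_eq0; rewrite -[LHS]sqr_sqrtr ?l2sq_ge0//.
by rewrite h expr0n.
Qed.

HB.instance Definition _ := Lmodule_isNormed.Build R[i] l2
  l2norm_triangle l2normZ l2norm_eq0.

Lemma l2_normE x : `|x| = (Num.sqrt (l2sq x))%:C.
Proof. by []. Qed.

End l2_inner.

Section l2_complete.
Context {R : realType} {I : choiceType}.
Local Notation l2 := (l2 R I).

Lemma l2_ball (x y : l2) (e : R) : 0 < e ->
  ball x e%:C y <-> l2sq (x - y) < e ^+ 2.
Proof.
move=> e0; rewrite -ball_normE /= l2_normE ltcR.
by rewrite -{1}[e]ger0_norm ?(ltW e0)// -sqrtr_sqr ltr_sqrt// exprn_gt0.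
Qed.

Lemma l2_lipschitz_cvg (F : set_system l2) (phi : l2 -> R) :
  ProperFilter F -> cauchy F ->
  (forall x y, (phi x - phi y) ^+ 2 <= l2sq (x - y)) -> cvg (phi @ F).
Proof.
move=> PF cF lip; apply: cauchy_cvg; apply/cauchyP => e e0.
have /cauchyP cF' := cF.
have [|x Fx] := cF' e%:C; first by rewrite ltcR.
exists (phi x); rewrite /fmap /=.
apply: filterS Fx => y /(l2_ball _ _ e0) h; rewrite -ball_normE /=.
rewrite -(ltr_pXn2r (n := 2))// ?nnegrE// ?(ltW e0)// real_normK ?num_real//.
exact: le_lt_trans (lip _ _) h.
Qed.

(** The candidate limit [l] is taken coordinatewise.  For [a] far along the
    filter every finite sum of [|a_i - b_i|^2] is small uniformly in later [b],
    hence so is every finite sum of [|a_i - l_i|^2]. *)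
Lemma l2_complete (F : set_system l2) : ProperFilter F -> cauchy F -> cvg F.
Proof.
move=> PF cF.
have cRe i : cvg ((fun x : l2 => complex.Re (x i)) @ F).
  apply: l2_lipschitz_cvg => // x y; apply: le_trans (l2sq_ge (x - y) i).
  by rewrite l2D l2N /sqn; case: (x i) (y i) => a b [c d] /=; rewrite lerDl sqr_ge0.
have cIm i : cvg ((fun x : l2 => complex.Im (x i)) @ F).
  apply: l2_lipschitz_cvg => // x y; apply: le_trans (l2sq_ge (x - y) i).
  by rewrite l2D l2N /sqn; case: (x i) (y i) => a b [c d] /=; rewrite lerDr sqr_ge0.
pose l (i : I) : R[i] := lim ((fun x : l2 => complex.Re (x i)) @ F) +i*
                   lim ((fun x : l2 => complex.Im (x i)) @ F).
have csum (a : l2) (s : seq I) :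
    (fun b : l2 => \sum_(i <- s) sqn (a i - b i)) @ F --> \sum_(i <- s) sqn (a i - l i).
  elim: s => [|i s ih].
    rewrite big_nil; under eq_fun do rewrite big_nil; exact: cvg_cst.
  rewrite big_cons; under eq_fun do rewrite big_cons.
  apply: cvgD => //.
  rewrite /sqn.
  have -> : complex.Re (a i - l i) = complex.Re (a i) - complex.Re (l i) by case: (a i).
  have -> : complex.Im (a i - l i) = complex.Im (a i) - complex.Im (l i) by case: (a i).
  have -> : (fun b : l2 => complex.Re (a i - b i) ^+ 2 + complex.Im (a i - b i) ^+ 2) =
     (fun b : l2 => (complex.Re (a i) - complex.Re (b i)) * (complex.Re (a i) - complex.Re (b i))
       + (complex.Im (a i) - complex.Im (b i)) * (complex.Im (a i) - complex.Im (b i))).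
    by apply/funext => b; case: (a i) (b i) => ? ? [].
  rewrite !expr2; apply: cvgD; apply: cvgM; apply: cvgB; do ?[exact: cvg_cst | exact: cRe | exact: cIm].
have key (e : R) : 0 < e -> F [set a : l2 | summableR (fun i => sqn (a i - l i)) /\
    sumR (fun i => sqn (a i - l i)) <= e].
  move=> e0; have /cauchy_ballP cF' := cF.
  pose e' := Num.sqrt e; have e'0 : 0 < e' by rewrite sqrtr_gt0.
  have /nearP_dep : \forall a & b \near F, ball a e'%:C b by apply: cF'; rewrite ltcR.
  apply: filterS => a Fa.
  apply: sumR_le => [i|A]; first exact: sqn_ge0.
  rewrite -(cvg_lim _ (csum a A))//; apply: limr_le.
    by apply/cvg_ex; eexists; exact: csum.
  apply: filterS Fa => b /(l2_ball _ _ e'0) /ltW; rewrite sqr_sqrtr ?(ltW e0)// => h.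
  exact: le_trans (sumR_fset_le A (l2_summable (a - b))) h.
have [a [sa _]] := filter_ex (key 1 ltr01).
have dP : (fun i => a i - l i) \in l2_pred by exact/l2_predP.
pose L : l2 := a - L2 dP.
have Ll i : L i = l i by rewrite /L l2D l2N /= subKr.
apply/cvg_ex; exists L; apply/cvg_ballP => e e0.
have eE : e = (complex.Re e)%:C by rewrite RRe_real// gtr0_real.
have e'0 : 0 < complex.Re e by rewrite -ltcR -eE.
have := key ((complex.Re e) ^+ 2 / 2).
rewrite divr_gt0 ?exprn_gt0// => /(_ isT).
apply: filterS => b [sb hb].
rewrite eE; apply: ball_sym; apply/l2_ball => //.
have -> : l2sq (b - L) = sumR (fun i => sqn (b i - l i)).
  by congr sumR; apply/funext => i; rewrite l2D l2N Ll.
apply: le_lt_trans hb _; rewrite ltr_pdivrMr// ltr_pMr ?exprn_gt0//.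
by rewrite ltr1n.
Qed.

HB.instance Definition _ := Uniform_isComplete.Build l2 l2_complete.

Lemma l2_inner_normE (x : l2) : `|x| ^+ 2 = (l2dot x x : R[i]).
Proof. by rewrite l2_normE -rmorphXn/= sqr_sqrtr ?l2sq_ge0// l2dot_sq. Qed.

HB.instance Definition _ := CompleteNormedModule_isHilbert.Build R l2 l2_inner_normE.

Lemma l2_innerE (x y : l2) : '[x, y] = l2dot x y.
Proof. by []. Qed.

Lemma l2_rdotE (x y : l2) : rdot x y = l2re x y.
Proof. by []. Qed.

Lemma l2_nrm (x : l2) : nrm x ^+ 2 = l2sq x.
Proof. by rewrite nrm_sqr l2_rdotE l2re_sq. Qed.

End l2_complete.

Section l2_basis.
Context {R : realType} {I : choiceType}.
Local Notation l2 := (l2 R I).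

Lemma l2_delta_subproof (j : I) : (fun i => (i == j)%:R : R[i]) \in l2_pred.
Proof.
apply/l2_predP.
have [] // := @sumR_supp1 R I (fun i => sqn ((i == j)%:R : R[i])) j.
  by move=> i; exact: sqn_ge0.
by move=> i /negPf ->; exact: sqn0.
Qed.

Definition l2_delta (j : I) : l2 := L2 (l2_delta_subproof j).

Lemma l2_deltaE j i : l2_delta j i = (i == j)%:R.
Proof. by []. Qed.

(** [|delta_j + x|^2] and [|x|^2] differ only in the coordinate [j]. *)
Lemma l2re_delta j (x : l2) : l2re (l2_delta j) x = complex.Re (x j).
Proof.
have : l2sq (l2_delta j + x) + sqn (x j) = l2sq x + sqn (1 + x j).
  pose f i := if i == j then sqn (x j) else 0.
  pose g i := if i == j then sqn (1 + x j) else 0.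
  have [] := @sumR_supp1 R I f j.
  - by move=> i; rewrite /f; case: ifP => // _; exact: sqn_ge0.
  - by move=> i /negPf; rewrite /f => ->.
  have [] := @sumR_supp1 R I g j.
  - by move=> i; rewrite /g; case: ifP => // _; exact: sqn_ge0.
  - by move=> i /negPf; rewrite /g => ->.
  have -> : f j = sqn (x j) by rewrite /f eqxx.
  have -> : g j = sqn (1 + x j) by rewrite /g eqxx.
  move=> sg <- sf <-.
  rewrite /l2sq -!sumRD//; do ?[exact: l2_summable].
  congr sumR; apply/funext => i; rewrite l2D l2_deltaE /f /g.
  by case: eqVneq => [->|_]; rewrite ?add0r ?addr0 1?addrC.
have : l2sq (l2_delta j) = 1.
  have [||_ e] := @sumR_supp1 R I (fun i => sqn ((i == j)%:R : R[i])) j.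
  - by move=> i; exact: sqn_ge0.
  - by move=> i /negPf ->; exact: sqn0.
  by rewrite /l2sq e eqxx /sqn/= expr1n expr0n addr0.
rewrite /l2re /sqn; case: (x j) => a b /=; lra.
Qed.

Lemma inner_delta j (x : l2) : '[l2_delta j, x] = (x j)^*%C.
Proof.
rewrite l2_innerE /l2dot !l2re_delta l2Z.
by case: (x j) => a b /=; congr (_ +i* _); ring.
Qed.

Lemma inner_delta_r j (x : l2) : '[x, l2_delta j] = x j.
Proof. by rewrite innerC inner_delta conjcK. Qed.

(** The sum is the truncation [y] of [x] to a finite set carrying all but [e^2] of
    [|x|^2], and [|x|^2 = |x - y|^2 + |y|^2]. *)
Lemma l2_delta_dense (x : l2) (e : R) : 0 < e ->
  exists s : seq I, nrm (x - \sum_(i <- s) x i *: l2_delta i) < e.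
Proof.
move=> e0.
have [F hF] := sumR_approx (l2_summable x) (exprn_gt0 2 e0).
exists F; rewrite -ltr_sqr ?nnegrE ?nrm_ge0 ?(ltW e0)// l2_nrm.
set y := \sum_(i <- F) _.
have yE i : y i = if i \in F then x i else 0.
  have -> : y i = \sum_(j <- F) x j * (i == j)%:R.
    rewrite /y; elim: (F : seq I) => [|k s ih]; first by rewrite !big_nil.
    by rewrite !big_cons l2D ih.
  case: ifPn => iF.
    rewrite (big_fsetD1 i)//= eqxx mulr1 big_seq big1 ?addr0// => k.
    by rewrite !inE eq_sym => /andP[/negPf -> _]; rewrite mulr0.
  rewrite big_seq big1// => k kF; rewrite (negPf (_ : i != k)) ?mulr0//.
  by apply: contraNneq iF => ->.
have : l2sq x = l2sq (x - y) + l2sq y.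
  rewrite /l2sq -sumRD; do ?[exact: l2_summable].
  congr sumR; apply/funext => i; rewrite l2D l2N yE.
  by case: ifP => _; rewrite ?subrr ?subr0 sqn0 ?add0r ?addr0.
have : \sum_(i <- F) sqn (x i) <= l2sq y.
  have := sumR_fset_le F (l2_summable y).
  by under eq_big_seq => i iF do rewrite yE iF.
move: hF; rewrite -/(l2sq x); lra.
Qed.

End l2_basis.

(** * Spectrum of a positive operator *)

Section spectrum_lemmas.
Context {R : realType} {H : hilbertType R}.
Implicit Types (T S : H -> H) (l c : R[i]).

Lemma bounded_comp T S : bounded_op T -> bounded_op S -> bounded_op (T \o S).
Proof.
move=> /bounded_opP[lT [M M0 TM]] /bounded_opP[lS [N N0 SN]].
apply/bounded_opP; split; first exact: linear_comp.
exists (M * N) => [|x /=]; first exact: mulr_ge0.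
by apply: le_trans (TM _) _; rewrite -mulrA ler_wpM2l.
Qed.

Lemma bounded_scale c : bounded_op (fun x : H => c *: x).
Proof.
apply/bounded_opP; split.
  by move=> a x y; rewrite scalerDr !scalerA mulrC.
by exists (complex.Re `|c|) => [|x]; [exact: Re_norm_ge0|rewrite nrmZ].
Qed.

Lemma bounded_add T S : bounded_op T -> bounded_op S ->
  bounded_op (fun x => T x + S x).
Proof.
move=> /bounded_opP[lT [M M0 TM]] /bounded_opP[lS [N N0 SN]].
apply/bounded_opP; split.
  by move=> a x y; rewrite lT lS scalerDr addrACA.
exists (M + N) => [|x /=]; first exact: addr_ge0.
by apply: le_trans (nrmD _ _) _; rewrite mulrDl lerD.
Qed.

Lemma bounded_shift T l : bounded_op T -> bounded_op (fun x => T x - l *: x).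
Proof.
move=> bT; have := bounded_add bT (bounded_scale (- l)).
by under eq_fun do rewrite scaleNr.
Qed.

Lemma not_spectrum_coercive T l c (d : R) : bounded_op T -> 0 < d -> c != 0 ->
  (forall x, d * nrm x ^+ 2 <= rdot (c *: (T x - l *: x)) x) -> ~ spectrum T l.
Proof.
move=> bT d0 c0 coerc; apply.
have bP := bounded_comp (bounded_scale c) (bounded_shift l bT).
have [S [bS PS SP]] := coercive_invertible bP d0 coerc.
exists (fun x => S (c *: x)); split.
- exact: bounded_comp bS (bounded_scale c).
- by move=> x; exact: PS.
- move=> x; have /= := SP (c *: x) => /(congr1 (fun z => c^-1 *: z)).
  by rewrite !scalerA mulVf// !scale1r.
Qed.

Lemma sym_inner T x : symmetric_map T -> '[T x, x] = (rdot (T x) x)%:C.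
Proof.
move=> sT; have := innerC (T x) x; rewrite -sT /rdot.
by case: '[T x, x] => a b [] /= h; congr (_ +i* _); lra.
Qed.

(** A scalar [l] off [[A, B]] makes [c (T - l)] coercive for one of
    [c = 1, -1, i, -i], according to whether [Re l < A], [Re l > B],
    [Im l > 0] or [Im l < 0]. *)
Lemma spectrum_sub_itv T (A B : R) : bounded_op T -> symmetric_map T ->
  (forall x, A * nrm x ^+ 2 <= rdot (T x) x <= B * nrm x ^+ 2) ->
  spectrum T `<=` [set x%:C | x in `[A, B]].
Proof.
move=> bT sT bnd l spl.
have rE c x : rdot (c *: (T x - l *: x)) x =
    complex.Re c * rdot (T x) x - complex.Re (c * l) * nrm x ^+ 2.
  rewrite /rdot innerZl innerDl -scaleNr innerZl inner_nrm sym_inner//.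
  by case: c l {spl} => p q [u v] /=; ring.
case: l spl rE => u v spl rE.
have Au : A <= u.
  rewrite leNgt; apply/negP => uA.
  apply: (@not_spectrum_coercive T (u +i* v) 1 (A - u)) spl => //.
    by rewrite subr_gt0.
  by move=> x; rewrite rE /=; have /andP[h _] := bnd x; lra.
have uB : u <= B.
  rewrite leNgt; apply/negP => uB.
  apply: (@not_spectrum_coercive T (u +i* v) (-1) (u - B)) spl => //.
  - by rewrite subr_gt0.
  - by move=> x; rewrite rE /=; have /andP[_ h] := bnd x; lra.
have iN0 : 'i%C != 0 :> R[i] by rewrite eq_complex /= oner_eq0 andbF.
have v0 : v = 0.
  have [vn|vp|//] := ltgtP v 0.
  - exfalso; apply: (@not_spectrum_coercive T (u +i* v) (- 'i%C) (- v)) spl => //.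
    + by rewrite oppr_gt0.
    + by rewrite oppr_eq0.
    + by move=> x; rewrite rE /=; lra.
  - exfalso; apply: (@not_spectrum_coercive T (u +i* v) 'i%C v) spl => //.
    by move=> x; rewrite rE /=; lra.
by exists u; [rewrite /= in_itv/= Au uB|rewrite v0].
Qed.

(** [T^2 - l^2 = (T - l)(T + l)]. *)
Lemma square_left_inverse T (l : R) : linear T ->
  ~ spectrum T l%:C -> ~ spectrum T (- l)%:C ->
  exists2 W, bounded_op W & forall x, W (T (T x) - (l ^+ 2)%:C *: x) = x.
Proof.
move=> lT /contrapT[S1 [b1 h1 _]] /contrapT[S2 [b2 h2 _]].
exists (S2 \o S1); first exact: bounded_comp.
move=> x /=.
have -> : T (T x) - (l ^+ 2)%:C *: x = T (T x - (- l)%:C *: x) - l%:C *: (T x - (- l)%:C *: x).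
  rewrite (linB lT) (linZ lT) scalerBr scalerA -rmorphM mulrN rmorphN !scaleNr !opprK.
  by rewrite rmorphN scaleNr opprK opprD addrA addrK expr2.
by rewrite h1 h2.
Qed.

(** [T^2 - A^2] is positive and, if neither [A] nor [- A] is in the spectrum,
    invertible; hence it is bounded below by some [d > 0]. *)
Lemma spectrum_lower_edge T (A B : R) : linear T -> symmetric_map T ->
  0 < B ->
  (forall x, A ^+ 2 * nrm x ^+ 2 <= rdot (T (T x)) x <= B ^+ 2 * nrm x ^+ 2) ->
  ~ spectrum T A%:C -> ~ spectrum T (- A)%:C ->
  exists2 d, 0 < d & forall x, (A ^+ 2 + d) * nrm x ^+ 2 <= rdot (T (T x)) x.
Proof.
move=> lT sT B0 bnd n1 n2; have [W bW hW] := square_left_inverse lT n1 n2.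
pose P x := T (T x) - (A ^+ 2)%:C *: x.
have rP x : rdot (P x) x = rdot (T (T x)) x - A ^+ 2 * nrm x ^+ 2.
  by rewrite /P !rdotE -nrm_sqr.
have lP : linear P.
  by move=> a x y; rewrite /P !lT scalerBr scalerDr opprD addrACA !scalerA mulrC.
have sP : symmetric_map P.
  by apply: rdot_sym => // x y; rewrite /P !rdotE !(sym_rdot sT).
have [z|d d0 hd] := pos_invertible_coercive lP sP (exprn_gt0 2 B0) _ bW hW.
  have /andP[h1 h2] := bnd z; rewrite rP subr_ge0 h1/=.
  have := mulr_ge0 (sqr_ge0 A) (sqr_ge0 (nrm z)); lra.
by exists d => // x; have := hd x; rewrite rP; lra.
Qed.

(** The same argument with [B^2 - T^2]. *)
Lemma spectrum_upper_edge T (A B : R) : linear T -> symmetric_map T ->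
  0 < B ->
  (forall x, A ^+ 2 * nrm x ^+ 2 <= rdot (T (T x)) x <= B ^+ 2 * nrm x ^+ 2) ->
  ~ spectrum T B%:C -> ~ spectrum T (- B)%:C ->
  exists2 d, 0 < d & forall x, rdot (T (T x)) x <= (B ^+ 2 - d) * nrm x ^+ 2.
Proof.
move=> lT sT B0 bnd n1 n2; have [W bW hW] := square_left_inverse lT n1 n2.
pose P x := (B ^+ 2)%:C *: x - T (T x).
have rP x : rdot (P x) x = B ^+ 2 * nrm x ^+ 2 - rdot (T (T x)) x.
  by rewrite /P !rdotE -nrm_sqr.
have lP : linear P.
  by move=> a x y; rewrite /P !lT scalerBr scalerDr opprD addrACA !scalerA mulrC.
have sP : symmetric_map P.
  by apply: rdot_sym => // x y; rewrite /P !rdotE !(sym_rdot sT).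
have hW' : cancel P (W \o (fun x => -1 *: x)).
  by move=> x; rewrite /P /= scaleN1r opprB hW.
have bW' := bounded_comp bW (bounded_scale (-1)).
have [z|d d0 hd] := pos_invertible_coercive lP sP (exprn_gt0 2 B0) _ bW' hW'.
  have /andP[h1 h2] := bnd z; rewrite rP subr_ge0 h2/=.
  have := mulr_ge0 (sqr_ge0 A) (sqr_ge0 (nrm z)); lra.
by exists d => // x; have := hd x; rewrite rP; lra.
Qed.

End spectrum_lemmas.

(** * Optimal frame bounds *)

Section frames.
Context {R : realType} {H : hilbertType R} {I : choiceType}.
Variables (D : set I) (phi : I -> H) (a b : R).
Hypothesis opt : optimal_frame_bounds D phi a b.

Let frame_sum g : \bar R := (\esum_(i in D) (complex.Re (`|'[g, phi i]| ^+ 2))%:E)%R.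

Let nrm2E (g : H) : complex.Re (`|g| ^+ 2) = nrm g ^+ 2.
Proof. by rewrite normE -rmorphXn. Qed.

Let frame_sum_ge0 g : (0 <= frame_sum g)%E.
Proof. by apply: esum_ge0 => i _; rewrite lee_fin sqnE sqn_ge0. Qed.

(** Each quotient [frame_sum g / |g|^2] lies above every admissible lower bound and
    below every admissible upper bound, hence above their supremum [a] and below
    their infimum [b]. *)
Lemma optimal_frame_ineq g :
  ((a * nrm g ^+ 2)%:E <= frame_sum g <= (b * nrm g ^+ 2)%:E)%E.
Proof.
have [[a0 [b0 [ab0 fr0]]] [uba leasta] [lbb greatb]] := opt.
have /= := fr0 g; rewrite -/(frame_sum g) nrm2E => -[h1 h2].
have fin : frame_sum g \is a fin_num.
  by rewrite ge0_fin_numE//; apply: le_lt_trans h2 _; rewrite ltry.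
have [n0|n0] := eqVneq (nrm g) 0.
  by move: h1 h2; rewrite n0 expr0n !mulr0 => -> ->.
have n2 : 0 < nrm g ^+ 2 by rewrite exprn_gt0// lt_neqAle eq_sym n0 nrm_ge0.
rewrite -[frame_sum g]fineK// !lee_fin; apply/andP; split.
  rewrite -ler_pdivlMr//; apply: leasta => a' [b' [_ /(_ g)/= [h _]]].
  by move: h; rewrite -/(frame_sum g) nrm2E -[frame_sum g]fineK// lee_fin ler_pdivlMr.
rewrite -ler_pdivrMr//; apply: greatb => b' [a' [_ /(_ g)/= [_ h]]].
by move: h; rewrite -/(frame_sum g) nrm2E -[frame_sum g]fineK// lee_fin ler_pdivrMr.
Qed.

Lemma optimal_lower_bound a' : 0 < a' ->
  (forall g, ((a' * nrm g ^+ 2)%:E <= frame_sum g)%E) -> a' <= a.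
Proof.
move=> a'0 h; have [_ [uba _] _] := opt; apply: uba.
exists (Num.max a' b); split; first by rewrite a'0 le_max lexx.
move=> g /=; rewrite -/(frame_sum g) nrm2E; split => //.
have /andP[_ h2] := optimal_frame_ineq g; apply: le_trans h2 _.
by rewrite lee_fin ler_wpM2r ?sqr_ge0// le_max lexx orbT.
Qed.

Lemma optimal_upper_bound b' : 0 < a -> 0 < b' ->
  (forall g, (frame_sum g <= (b' * nrm g ^+ 2)%:E)%E) -> b <= b'.
Proof.
move=> a0 b'0 h; have [_ _ [lbb _]] := opt; apply: lbb.
exists (Num.min a b'); split; first by rewrite lt_min a0 b'0/= ge_min lexx orbT.
move=> g /=; rewrite -/(frame_sum g) nrm2E; split => //.
have /andP[h2 _] := optimal_frame_ineq g; apply: le_trans h2.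
by rewrite lee_fin ler_wpM2r ?sqr_ge0// ge_min lexx.
Qed.

End frames.

(** * Shifts, restrictions and isometric embeddings *)

Section shift.
Context {R : realType} {I : choiceType}.
Local Notation l2 := (l2 R I).

Lemma l2_shift_subproof (p : I -> I) (bp : bijective p) (x : l2) :
  (fun i => x (p i)) \in l2_pred.
Proof. by apply/l2_predP; have [] := sumR_reindex bp (l2_summable x). Qed.

Definition l2_shift p (bp : bijective p) (x : l2) : l2 := L2 (l2_shift_subproof bp x).

Lemma l2_shift_linear p (bp : bijective p) : linear (l2_shift bp).
Proof. by move=> a x y; exact: l2_ext. Qed.

Lemma l2_shift_inner p (bp : bijective p) x y :
  '[l2_shift bp x, l2_shift bp y] = '[x, y].
Proof.
have sq z : l2sq (l2_shift bp z) = l2sq z.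
  by have [_] := sumR_reindex bp (l2_summable z).
have re z w : l2re (l2_shift bp z) (l2_shift bp w) = l2re z w.
  by rewrite /l2re -{1}[l2_shift bp z]scale1r -l2_shift_linear !sq scale1r.
by rewrite !l2_innerE /l2dot -(linZ (l2_shift_linear bp)) !re.
Qed.

End shift.

Lemma restr_eq (R : realType) (H K : hilbertType R) (J : H -> K)
    (T : K -> K) (S : H -> H) : injective J ->
  (forall x, J (S x) = T (J x)) -> restr J T = S.
Proof.
move=> injJ h; apply/funext => x; rewrite /restr; apply: injJ.
by rewrite h; apply: (@xgetPex _ 0 [set y | J y = T (J x)]); exists (S x).
Qed.

Section isometric_embedding.
Context {R : realType} {H K : hilbertType R}.
Variables (J : H -> K) (J' : K -> H).
Hypothesis linJ : linear J.
Hypothesis isoJ : forall x y, '[J x, J y] = '[x, y].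
Hypothesis adjJ : forall x y, '[J x, y] = '[x, J' y].

Lemma isometry_nrm x : nrm (J x) = nrm x.
Proof.
apply/eqP; rewrite -(eqrXn2 (n := 2))// ?nrm_ge0//.
by rewrite !nrm_sqr /rdot isoJ.
Qed.

Lemma isometry_inj : injective J.
Proof.
move=> x y e; apply/eqP; rewrite -subr_eq0; apply/eqP/nrm_eq0.
by rewrite -isometry_nrm (linB linJ) e subrr nrm0.
Qed.

Lemma isometry_adjointK : cancel J J'.
Proof. by move=> x; apply: inner_ext => z; rewrite -adjJ isoJ. Qed.

(** If [y] is the limit of [J x_n] then [J J' y] is the limit of
    [J J' J x_n = J x_n] too. *)
Lemma isometry_range_closed : (forall y, nrm (J' y) <= nrm y) -> linear J' ->
  closed (range J).
Proof.
move=> J'le linJ' y cy; exists (J' y) => //.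
apply: (@eq_geometric R K _ _ 4 2^-1) => [|n].
  by rewrite invr_ge0 ler0n /= invf_lt1// ltr1n.
have e0 : 0 < (2^-1 : R) ^+ n by rewrite exprn_gt0// invr_gt0.
have [|z [[x _ <-] hx]] := cy (ball y ((2^-1 : R) ^+ n)%:C).
  by apply: nbhsx_ballx; rewrite ltcR.
move: hx; rewrite -ball_normE /= normE ltcR => hx.
apply: le_trans (nrm_tri _ (J x) _) _.
rewrite -(linB linJ) isometry_nrm -{1}(isometry_adjointK x) -(linB linJ').
have := J'le (y - J x); have := nrmBC (J x) y; lra.
Qed.

End isometric_embedding.

(** * The left regular representation *)

Section group_representation.
Context {R : realType} {H : hilbertType R}.
Variable U : set (H -> H).
Hypothesis groupU : unitary_group U.

(** The group [U] as a type, so that the Hilbert space indexed by it is [l2]. *)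
Definition gelt : choiceType := set_type U.

Lemma geltP (g : gelt) : U (val g).
Proof. exact: (set_mem (valP g)). Qed.

Definition gelt_of T (UT : U T) : gelt := exist _ T (mem_set UT).

Definition gmul (g h : gelt) : gelt :=
  let: And4 _ _ hmul _ := groupU in gelt_of (hmul _ _ (geltP g) (geltP h)).

Lemma gmulE (g h : gelt) : val (gmul g h) = val g \o val h.
Proof. by rewrite /gmul; case: groupU. Qed.

Definition gone : gelt := let: And4 _ h1 _ _ := groupU in gelt_of h1.

Lemma goneE : val gone = idfun.
Proof. by rewrite /gone; case: groupU. Qed.

Lemma ginv_ex (g : gelt) :
  exists h : gelt, cancel (val g) (val h) /\ cancel (val h) (val g).
Proof.
have [_ _ _ /(_ _ (geltP g))[S US gS]] := groupU.
by exists (gelt_of US).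
Qed.

Definition ginv : gelt -> gelt := projT1 (choice ginv_ex).

Lemma ginvK (g : gelt) : cancel (val g) (val (ginv g)).
Proof. by have [] := projT2 (choice ginv_ex) g. Qed.

Lemma ginvVK (g : gelt) : cancel (val (ginv g)) (val g).
Proof. by have [] := projT2 (choice ginv_ex) g. Qed.

Lemma gelt_ext (g h : gelt) : (forall x, val g x = val h x) -> g = h.
Proof. by move=> e; apply/val_inj/funext. Qed.

Lemma gmul_ext (g h k : gelt) : (forall x, val g (val h x) = val k x) -> gmul g h = k.
Proof. by move=> e; apply: gelt_ext => x; rewrite gmulE /= e. Qed.

Lemma gmulVK g : cancel (gmul g) (gmul (ginv g)).
Proof. by move=> h; apply: gmul_ext => x; rewrite gmulE /= ginvK. Qed.

Lemma gmulKV g : cancel (gmul (ginv g)) (gmul g).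
Proof. by move=> h; apply: gmul_ext => x; rewrite gmulE /= ginvVK. Qed.

Lemma gmulV_bij g : bijective (gmul (ginv g)).
Proof. by exists (gmul g); [exact: gmulKV|exact: gmulVK]. Qed.

Local Notation l2 := (l2 R gelt).

Definition lreg (g : gelt) : l2 -> l2 := l2_shift (gmulV_bij g).

Lemma lregE g x s : lreg g x s = x (gmul (ginv g) s).
Proof. by []. Qed.

Lemma lreg_linear g : linear (lreg g).
Proof. exact: l2_shift_linear. Qed.

Lemma lreg_inner g x y : '[lreg g x, lreg g y] = '[x, y].
Proof. exact: l2_shift_inner. Qed.

Lemma lregM g h x : lreg g (lreg h x) = lreg (gmul g h) x.
Proof.
apply: l2_ext => s; rewrite !lregE; congr (x _).
apply: gmul_ext => z; rewrite !gmulE /=.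
apply: (can_inj (ginvK h)); rewrite ginvVK.
apply: (can_inj (ginvK g)); rewrite ginvVK.
by have := ginvVK (gmul g h) (val s z); rewrite gmulE /= => ->.
Qed.

Lemma lreg1 x : lreg gone x = x.
Proof.
apply: l2_ext => s; rewrite lregE; congr (x _).
apply: gmul_ext => z; apply: (can_inj (ginvK gone)).
by rewrite ginvVK goneE.
Qed.

Lemma lregK g : cancel (lreg g) (lreg (ginv g)).
Proof.
move=> x; rewrite lregM (_ : gmul _ _ = gone) ?lreg1//.
by apply: gmul_ext => z; rewrite ginvK goneE.
Qed.

Lemma lregVK g : cancel (lreg (ginv g)) (lreg g).
Proof.
move=> x; rewrite lregM (_ : gmul _ _ = gone) ?lreg1//.
by apply: gmul_ext => z; rewrite ginvVK goneE.
Qed.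

Lemma lreg_unitary g : unitary_op (lreg g).
Proof.
split; [exact: lreg_linear| |exact: lreg_inner].
by exists (lreg (ginv g)); [exact: lregK|exact: lregVK].
Qed.

Lemma lreg_group : unitary_group (range lreg).
Proof.
split.
- by move=> _ [g _ <-]; exact: lreg_unitary.
- by exists gone => //; apply/funext => x; exact: lreg1.
- move=> _ _ [g _ <-] [h _ <-]; exists (gmul g h) => //.
  by apply/funext => x; rewrite /= lregM.
- move=> _ [g _ <-]; exists (lreg (ginv g)); first by exists (ginv g).
  by split; [exact: lregK|exact: lregVK].
Qed.

Lemma lreg_delta g : lreg g (l2_delta gone) = l2_delta g.
Proof.
apply: l2_ext => s; rewrite lregE !l2_deltaE; congr (_%:R).
apply/congr1; apply/eqP/eqP => [h|->]; last first.
  by apply: gmul_ext => z; rewrite ginvK goneE.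
by rewrite -[LHS](gmulKV g) h; apply: gmul_ext => z; rewrite goneE.
Qed.

(** The orbit of the point mass at the identity consists of all the point masses
    ([lreg_delta]), each of them reached once. *)
Lemma lreg_wandering : complete_wandering_vector (range lreg) (l2_delta gone).
Proof.
split.
  move=> _ _ [g _ <-] [h _ <-]; rewrite !lreg_delta inner_delta l2_deltaE.
  rewrite conjc_nat; congr (_%:R); apply/congr1; apply/eqP/eqP => [->//|e].
  have := congr1 (fun L : l2 -> l2 => L (l2_delta gone) g) e.
  rewrite !lreg_delta !l2_deltaE eqxx; case: eqVneq => // _ /eqP.
  by rewrite oner_eq0.
apply/seteqP; split => // x _ B /nbhs_ballP[e /= e0 eB].
have eE : e = (complex.Re e)%:C by rewrite RRe_real// gtr0_real.
have e'0 : 0 < complex.Re e by rewrite -ltcR -eE.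
have [s hs] := l2_delta_dense x e'0.
exists (\sum_(i <- s) x i *: l2_delta i); split; last first.
  by apply: eB; rewrite -ball_normE /= normE eE ltcR.
(* the coefficient along L e is recovered as an inner product *)
exists [seq lreg i | i <- s], (fun L => '[x, L (l2_delta gone)]); split.
  by move=> _ /mapP[g _ ->]; exists g.
by rewrite big_map; apply: eq_bigr => i _; rewrite lreg_delta inner_delta_r.
Qed.

End group_representation.

(** * The frame operator and the dilation *)

Section frame_operator.
Context {R : realType} {H : hilbertType R}.
Variables (U : set (H -> H)) (f : H) (A B : R).
Hypothesis groupU : unitary_group U.
Hypotheses (A0 : 0 < A) (AB : A <= B).
Hypothesis opt : frame_vector_optimal U f (A ^+ 2) (B ^+ 2).

Local Notation G := (gelt U).
Local Notation l2 := (l2 R (gelt U)).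

Let B0 : 0 < B. Proof. exact: lt_le_trans A0 AB. Qed.

Lemma frame_sumE x :
  (\esum_(T in U) (complex.Re (`|'[x, T f]| ^+ 2))%:E)%R =
  (\esum_(g in [set: G]) (sqn '[x, val g f])%:E)%R.
Proof.
have bij : set_bij [set: G] U (fun g : G => val g).
  split; [by move=> g _; exact: geltP|by move=> g h _ _ /val_inj|].
  by move=> T UT; exists (gelt_of UT).
rewrite (reindex_esum setT U (fun g : G => val g) (fun T => (complex.Re (`|'[x, T f]| ^+ 2))%:E) bij).
by apply: eq_esum => g _; rewrite sqnE.
Qed.

Lemma analysis_subproof x : (fun g : G => '[x, val g f]) \in l2_pred.
Proof.
have /andP[_ h] := optimal_frame_ineq opt x.
by rewrite /l2_pred unfold_in -frame_sumE; apply: le_lt_trans h _; rewrite ltry.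
Qed.

Definition analysis x : l2 := L2 (analysis_subproof x).

Lemma analysisE x g : analysis x g = '[x, val g f].
Proof. by []. Qed.

Lemma analysis_linear : linear analysis.
Proof. by move=> a x y; apply: l2_ext => g; rewrite analysisE innerDl innerZl. Qed.

Lemma frame_sum_nrm x :
  (\esum_(T in U) (complex.Re (`|'[x, T f]| ^+ 2))%:E)%R = (nrm (analysis x) ^+ 2)%:E.
Proof. by rewrite frame_sumE l2_nrm -(sumRE (l2_summable (analysis x))). Qed.

Lemma analysis_bounds x :
  A ^+ 2 * nrm x ^+ 2 <= nrm (analysis x) ^+ 2 <= B ^+ 2 * nrm x ^+ 2.
Proof. by have := optimal_frame_ineq opt x; rewrite frame_sum_nrm !lee_fin. Qed.

(** [<T x, W f> = <x, T^-1 W f>] for unitary [T]. *)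
Lemma analysis_lreg (g : G) x : analysis (val g x) = lreg groupU g (analysis x).
Proof.
have [h _ _ _] := groupU; have [_ _ gU] := h _ (geltP g).
apply: l2_ext => s; rewrite lregE !analysisE gmulE -[in RHS]gU.
exact: (congr1 (fun z => '[val g x, z]) (esym (ginvVK groupU g _))).
Qed.

(** [S = analysis^* analysis]; it commutes with [U] because [analysis]
    intertwines [U] with a unitary representation. *)
Lemma frame_operator_exists : exists S : H -> H,
  [/\ linear S, symmetric_map S, forall x y, '[S x, y] = '[analysis x, analysis y]
    & forall (g : G) x, val g (S x) = S (val g x)].
Proof.
have an_le x : nrm (analysis x) <= B * nrm x.
  rewrite -ler_sqr ?nnegrE ?mulr_ge0 ?nrm_ge0 ?(ltW B0)// exprMn.
  by have /andP[] := analysis_bounds x.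
have [adj [linadj adjE _]] := adjoint_exists analysis_linear (ltW B0) an_le.
have SE x y : '[adj (analysis x), y] = '[analysis x, analysis y].
  by rewrite innerC -adjE -innerC.
have comm (g : G) x : val g (adj (analysis x)) = adj (analysis (val g x)).
  have [h _ _ _] := groupU; have [_ _ gU] := h _ (geltP g).
  apply: inner_ext => y; rewrite -(ginvVK groupU g y).
  move: (val (ginv groupU g) y) => z.
  by rewrite gU -!adjE !analysis_lreg lreg_inner.
exists (adj \o analysis); split => //.
- exact: (linear_comp linadj analysis_linear).
- by move=> x y; rewrite SE adjE.
Qed.

End frame_operator.

Theorem theorem2p1 (R : realType) (H : hilbertType R) (U : set (H -> H))
    (f : H) (A B : R) :
  unitary_group U ->
  0 < A -> A <= B ->
  frame_vector_optimal U f (A ^+ 2) (B ^+ 2) ->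
  exists (K : hilbertType R) (J : H -> K) (V : set (K -> K))
         (E : K -> K) (e : K),
    [/\ (* (i) *)
        [/\ hilbert_inclusion J, unitary_group V,
            forall T, V T -> invariant_range J T,
            set_bij V U (restr J)
          & forall S T, V S -> V T ->
              restr J (S \o T) = restr J S \o restr J T],
        (* (ii) *)
        [/\ positive_op E, range E `<=` range J,
            [set A%:C; B%:C] `<=` spectrum (restr J E)
          & spectrum (restr J E) `<=` [set x%:C | x in `[A, B]]]
      & (* (iii) *)
        [/\ complete_wandering_vector V e,
            forall T, V T -> E (T e) = T (J f),
            [set E (T e) | T in V] = [set T (J f) | T in V]
          & [set T (J f) | T in V] = J @` [set T f | T in U]]].
Proof.
move=> groupU A0 AB opt; have B0 : 0 < B := lt_le_trans A0 AB.
have [S [linS symS SE Scomm]] := frame_operator_exists groupU A0 AB opt.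
pose theta := analysis opt.
have Sbnd x : A ^+ 2 * nrm x ^+ 2 <= rdot (S x) x <= B ^+ 2 * nrm x ^+ 2.
  by rewrite /rdot SE -/(rdot _ _) -nrm_sqr analysis_bounds.
(* T is the square root of the frame operator S, and Ti its inverse *)
have [T [linT symT TT Tge Tcomm]] := sqrt_op A0 AB linS symS Sbnd.
have Tbnd x : A ^+ 2 * nrm x ^+ 2 <= rdot (T (T x)) x <= B ^+ 2 * nrm x ^+ 2.
  by rewrite TT.
have Tle x : nrm (T x) <= B * nrm x.
  rewrite -ler_sqr ?nnegrE ?mulr_ge0 ?nrm_ge0 ?(ltW B0)// exprMn nrm_sqr.
  by rewrite -(sym_rdot symT); have /andP[] := Tbnd x.
have bT : bounded_op T by apply/bounded_opP; split=> //; exists B => //; exact: ltW.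
have Titv x : A * nrm x ^+ 2 <= rdot (T x) x <= B * nrm x ^+ 2.
  rewrite Tge /=; apply: le_trans (cauchy_schwarz _ _) _.
  by rewrite expr2 mulrA ler_wpM2r ?nrm_ge0.
have specT := spectrum_sub_itv bT symT Titv.
have [Ti [bTi TK KT]] := coercive_invertible bT A0 Tge.
have [linTi _] := bTi.
have gunit (g : gelt U) : unitary_op (val g).
  by have [h _ _ _] := groupU; exact: h (geltP g).
have gT (g : gelt U) x : val g (T x) = T (val g x).
  have [lg _ ig] := gunit g; apply: Tcomm => [|y]; last exact: Scomm.
  apply/bounded_opP; split => //; exists 1 => // y.
  by rewrite mul1r (isometry_nrm ig).
have gTi (g : gelt U) x : val g (Ti x) = Ti (val g x).
  by apply: (can_inj TK); rewrite -gT !KT.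
(* the isometric part of theta in its polar decomposition theta = J T *)
pose J x := theta (Ti x).
have linJ : linear J by exact: (linear_comp (analysis_linear opt) linTi).
have isoJ x y : '[J x, J y] = '[x, y].
  by rewrite /J -SE -TT KT symT KT.
have Jnrm x : nrm (J x) <= 1 * nrm x by rewrite mul1r (isometry_nrm isoJ).
have [J' [linJ' adjJ J'le]] := adjoint_exists linJ ler01 Jnrm.
have J'le1 y : nrm (J' y) <= nrm y by have := J'le y; rewrite mul1r.
have adjJ' x y : '[J' y, x] = '[y, J x] by rewrite innerC -adjJ -innerC.
have injJ := isometry_inj linJ isoJ.
have J'J := isometry_adjointK isoJ adjJ.
have JT x : J (T x) = theta x by rewrite /J TK.
have lregJ (g : gelt U) x : J (val g x) = lreg groupU g (J x).
  by rewrite /J -gTi /theta (analysis_lreg groupU opt).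
have restrJ g : restr J (lreg groupU g) = val g.
  by apply: restr_eq => // x; exact: lregJ.
pose E y := J (T (J' y)).
have restrE : restr J E = T by apply: restr_eq => // x; rewrite /E J'J.
(* T J' is the synthesis operator theta^*, which sends point masses to U f *)
have Edelta (g : gelt U) : E (l2_delta g) = J (val g f).
  congr J; apply: inner_ext => y.
  by rewrite -symT -adjJ JT inner_delta_r analysisE.
have not_neg_spec l : 0 < l -> ~ spectrum (T : H -> H) (- l)%:C.
  move=> l0 /specT[x /=]; rewrite in_itv/= => /andP[Ax _] [xl].
  by move: l0 Ax; rewrite -[l]opprK -xl; lra.
exists (l2 R (gelt U)), J, (range (lreg groupU)), E, (l2_delta (gone groupU)).
split; split.
- split=> //; exact: (isometry_range_closed linJ isoJ adjJ J'le1 linJ').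
- exact: lreg_group.
- by move=> _ [g _ <-] _ [_ [x _ <-] <-]; exists (val g x).
- split.
  + by move=> _ [g _ <-]; rewrite /= restrJ; exact: geltP.
  + move=> L1 L2 /set_mem[g _ <-] /set_mem[h _ <-].
    by rewrite !restrJ => /val_inj ->.
  + by move=> W UW; exists (lreg groupU (gelt_of UW)); [exists (gelt_of UW)|rewrite restrJ].
- move=> _ _ [g _ <-] [h _ <-]; rewrite !restrJ.
  by apply: restr_eq => // x; rewrite /= !lregJ.
- have linE : linear E by exact: (linear_comp linJ (linear_comp linT linJ')).
  have EE x y : '[E x, y] = '[T (J' x), J' y] by rewrite /E adjJ.
  split.
  + apply/bounded_opP; split=> //; exists B => [|y]; first exact: ltW.
    rewrite (isometry_nrm isoJ); apply: le_trans (Tle _) _.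
    by rewrite ler_wpM2l ?(ltW B0).
  + by move=> x y; rewrite EE symT adjJ'.
  + move=> x; rewrite EE sym_inner// ler0c; apply: le_trans (Tge _).
    by rewrite mulr_ge0 ?sqr_ge0 ?(ltW A0).
- by move=> _ [y _ <-]; exists (T (J' y)).
- rewrite restrE => _ [] ->; apply: contrapT => nspec.
  + have [d d0 hd] := spectrum_lower_edge linT symT B0 Tbnd nspec (not_neg_spec _ A0).
    have : A ^+ 2 + d <= A ^+ 2.
      apply: (optimal_lower_bound opt) => [|x]; first by rewrite addr_gt0 ?exprn_gt0.
      rewrite (frame_sum_nrm opt) lee_fin; have := hd x.
      by rewrite TT /rdot SE -/(rdot _ _) -nrm_sqr.
    lra.
  + have [d d0 hd] := spectrum_upper_edge linT symT B0 Tbnd nspec (not_neg_spec _ B0).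
    have B20 : 0 < B ^+ 2 by rewrite exprn_gt0.
    (* keep the candidate upper bound positive *)
    pose d' := Num.min d (B ^+ 2 / 2).
    have d'0 : 0 < d' by rewrite lt_min d0 divr_gt0.
    have d'd : d' <= d by rewrite ge_min lexx.
    have d'B : d' <= B ^+ 2 / 2 by rewrite ge_min lexx orbT.
    have : B ^+ 2 <= B ^+ 2 - d'.
      apply: (optimal_upper_bound opt) => [||x]; [by rewrite exprn_gt0|lra|].
      rewrite (frame_sum_nrm opt) lee_fin; have := hd x.
      rewrite TT /rdot SE -/(rdot _ _) -nrm_sqr => h; apply: le_trans h _.
      by rewrite ler_wpM2r ?sqr_ge0// lerD2l lerN2.
    lra.
- by rewrite restrE.
- exact: lreg_wandering.
- by move=> _ [g _ <-]; rewrite lreg_delta Edelta lregJ.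
- by apply: eq_imagel => _ [g _ <-]; rewrite lreg_delta Edelta lregJ.
- apply/seteqP; split.
  + move=> _ [_ [g _ <-] <-]; exists (val g f); last by rewrite lregJ.
    by exists (val g) => //; exact: geltP.
  + move=> _ [_ [W UW <-] <-]; exists (lreg groupU (gelt_of UW)).
      by exists (gelt_of UW).
    by rewrite -lregJ.
Qed.
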